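(* Let $\mathbb{F}_q$ be a finite field and let $\alpha \in \mathbb{F}_q((t^{-1})) \setminus \mathbb{F}_q(t)$. Let $(q_n)_{n \in \mathbb{N}}$ be the sequence in $\mathbb{F}_q[t]$ of denominators of the convergents of the continued fraction expansion of $\alpha$. Then there is a free weakly mixing action $(T_g)_{g \in \mathbb{F}_q[t]}$ of the additive group $\mathbb{F}_q[t]$ such that $T_{q_n} \to \mathrm{id}$, i.e. such that $(q_n)_{n\in\mathbb{N}}$ is a rigidity sequence for this action.
   Context: For $x=\sum_{n=-\infty}^N c_nt^n\in\mathbb{F}_q((t^{-1}))$, let $[x]=\sum_{n=0}^N c_nt^n\in\mathbb{F}_q[t]$ and $\{x\}=x-[x]$. Let $\mathcal{T}=t^{-1}\mathbb{F}_q[[t^{-1}]]$ and define $S:\mathcal{T}\to\mathcal{T}$ by $S(x)=\{1/x\}$ for $x\ne0$ and $S(0)=0$. For $\alpha \in \mathbb{F}_q((t^{-1})) \setminus \mathbb{F}_q(t)$ set $a_0=[\alpha]$ and $a_n=\left[1/S^{n-1}(\{\alpha\})\right]$ for $n\ge1$; this gives the (infinite) continued fraction expansion $\alpha=[a_0;a_1,a_2,\dots]$. The denominators $q_n$ of the convergents $p_n/q_n=[a_0;a_1,\dots,a_n]$ are given by $q_0=1$, $q_1=a_1$, $q_n=a_nq_{n-1}+q_{n-2}$. For a countable discrete abelian group $\Gamma$ (here $\Gamma=(\mathbb{F}_q[t],+)$), a measure-preserving system (or action) is a quadruple $(X, \mathcal{B}, \mu, (T_g)_{g \in \Gamma})$,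 where $(X,\mathcal{B},\mu)$ is a non-atomic Lebesgue probability space and $(T_g)_{g\in\Gamma}$ is an action of $\Gamma$ by measure-preserving transformations. A sequence $(a_n)$ in $\Gamma$ is a rigidity sequence for the system if $\|f\circ T_{a_n} - f\|_2 \to 0$ for every $f \in L^2(\mu)$; this is what $T_{a_n}\to\mathrm{id}$ means. The system is free if $\mu(\{x\in X : T_gx = x\}) = 0$ for every $g\in\Gamma\setminus\{0\}$. It is weakly mixing if $\frac{1}{|\Phi_N|}\sum_{g\in\Phi_N} |\mu(A\cap T_gB)-\mu(A)\mu(B)| \to 0$ for all $A,B\in\mathcal{B}$ and every F{\o}lner sequence $(\Phi_N)$ in $\Gamma$ (finite nonempty sets with $|(\Phi_N+x)\triangle\Phi_N|/|\Phi_N|\to0$ for every $x\in\Gamma$). *)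

(* Defs.v *)
From HB Require Import structures.
From mathcomp Require Import all_boot all_order all_algebra finmap.
From mathcomp Require Import zify.
From mathcomp Require Import all_classical all_reals all_analysis.
Set Implicit Arguments.
Unset Strict Implicit.
Unset Printing Implicit Defensive.
Import Order.TTheory GRing.Theory Num.Theory.
Import numFieldNormedType.Exports.
Local Open Scope classical_set_scope.
Local Open Scope ring_scope.

Definition bounded_above (F : fieldType) (c : int -> F) (N : int) :=
  forall n, N < n -> c n = 0.

(* [laurent F] is the field F((t^-1)): [x n] is the coefficient of t^n in x, and
   the exponents of the nonzero coefficients are bounded above. *)
Record laurent (F : fieldType) := Laurent {
  lcoef :> int -> F;
  lcoefP : exists N, bounded_above lcoef N }.

HB.instance Definition _ (F : fieldType) := gen_eqMixin (laurent F).
HB.instance Definition _ (F : fieldType) := gen_choiceMixin (laurent F).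

Section LaurentField.
Variable F : fieldType.
Implicit Types (c d : int -> F) (x y z : laurent F) (N M n : int).

Lemma laurentP x y : lcoef x = lcoef y -> x = y.
Proof.
case: x y => [c cP] [d dP] /= cd; move: cP dP; rewrite cd => cP dP.
by congr Laurent; apply: Prop_irrelevance.
Qed.

Lemma bounded_aboveW c N M : N <= M -> bounded_above c N -> bounded_above c M.
Proof. by move=> NM cN n Mn; apply/cN/(le_lt_trans NM). Qed.

Lemma lzero_subproof : exists N, bounded_above (fun=> 0 : F) N.
Proof. by exists 0. Qed.
Definition lzero := Laurent lzero_subproof.

Lemma lone_subproof : exists N, bounded_above (fun n => (n == 0)%:R : F) N.
Proof. by exists 0 => n; case: eqP => // ->; rewrite ltxx. Qed.
Definition lone := Laurent lone_subproof.

Lemma lopp_subproof x : exists N, bounded_above (fun n => - x n) N.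
Proof.
by have [N xN] := lcoefP x; exists N => n Nn; rewrite xN ?oppr0.
Qed.
Definition lopp x := Laurent (lopp_subproof x).

Lemma ladd_subproof x y : exists N, bounded_above (fun n => x n + y n) N.
Proof.
have [N xN] := lcoefP x; have [M yM] := lcoefP y; exists (Num.max N M) => n.
by rewrite gt_max => /andP[Nn Mn]; rewrite xN ?yM ?addr0.
Qed.
Definition ladd x y := Laurent (ladd_subproof x y).

(* A finitely supported sum, since both factors are bounded above. *)
Definition lmul_coef c d n : F := \sum_(i \in [set: int]) c i * d (n - i).

Lemma lmul_coefE c d N M (k : nat) :
  bounded_above c N -> bounded_above d M ->
  lmul_coef c d (N + M - k%:Z) =
    \sum_(j < k.+1) c (N - j%:Z) * d (M - (k - j)%N%:Z).
Proof.
move=> cN dM; pose h (j : nat) : int := N - j%:Z.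
have hI : injective h by move=> i j; rewrite /h; lia.
rewrite /lmul_coef (fsbigE (map h (iota 0 k.+1)))//.
- rewrite big_map -[iota 0 k.+1]/(index_iota 0 k.+1).
  rewrite (eq_bigl xpredT); last by move=> j; rewrite mem_set.
  rewrite big_mkord; apply: eq_bigr => j _; congr (c _ * d _).
  by have := ltn_ord j; rewrite /h; lia.
- by rewrite map_inj_uniq ?iota_uniq.
- move=> i _ iP; have [Ni|iN] := ltP N i; first by rewrite cN ?mul0r.
  have [Mi|iM] := ltP M (N + M - k%:Z - i); first by rewrite dM ?mulr0.
  case/negP: iP; apply/mapP; exists `|N - i|%N; last by rewrite /h; lia.
  by rewrite mem_iota; lia.
Qed.

Lemma lmul_coef0 c d N M :
  bounded_above c N -> bounded_above d M ->
  bounded_above (lmul_coef c d) (N + M).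
Proof.
move=> cN dM n NMn; apply: fsbig1 => i _.
have [Ni|iN] := ltP N i; first by rewrite cN ?mul0r.
by rewrite dM ?mulr0//; lia.
Qed.

Lemma lmul_subproof x y : exists N, bounded_above (lmul_coef x y) N.
Proof.
have [N xN] := lcoefP x; have [M yM] := lcoefP y.
by exists (N + M); apply: lmul_coef0.
Qed.
Definition lmul x y := Laurent (lmul_subproof x y).

(* The top [k] coefficients as a polynomial in t^-1. *)
Let trunc c N k := \poly_(j < k) c (N - j%:Z).

Lemma coef_trunc c N k j : (j < k)%N -> (trunc c N k)`_j = c (N - j%:Z).
Proof. by move=> jk; rewrite coef_poly jk. Qed.

Lemma trunc_lmul c d N M K k : (k < K)%N ->
  bounded_above c N -> bounded_above d M ->
  lmul_coef c d (N + M - k%:Z) = (trunc c N K * trunc d M K)`_k.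
Proof.
move=> kK cN dM; rewrite lmul_coefE// coefM; apply: eq_bigr => j _.
by have := ltn_ord j => jk; rewrite !coef_trunc//; lia.
Qed.

Lemma bounded_aboveP c d N : bounded_above c N -> bounded_above d N ->
  (forall k : nat, c (N - k%:Z) = d (N - k%:Z)) -> c = d.
Proof.
move=> cN dN cd; apply/funext => n.
have [Nn|nN] := ltP N n; first by rewrite cN ?dN.
by rewrite (_ : n = N - `|N - n|%N%:Z) ?cd//; lia.
Qed.

Lemma laddA : associative ladd.
Proof. by move=> x y z; apply/laurentP/funext => n /=; rewrite addrA. Qed.
Lemma laddC : commutative ladd.
Proof. by move=> x y; apply/laurentP/funext => n /=; rewrite addrC. Qed.
Lemma ladd0l : left_id lzero ladd.
Proof. by move=> x; apply/laurentP/funext => n /=; rewrite add0r. Qed.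
Lemma laddNl : left_inverse lzero lopp ladd.
Proof. by move=> x; apply/laurentP/funext => n /=; rewrite addNr. Qed.

HB.instance Definition _ :=
  GRing.isZmodule.Build (laurent F) laddA laddC ladd0l laddNl.

Lemma lmulC : commutative lmul.
Proof.
move=> x y; have [N xN] := lcoefP x; have [M yM] := lcoefP y.
apply/laurentP/(@bounded_aboveP _ _ (N + M)) => [||k] /=.
- exact: lmul_coef0.
- by rewrite (addrC N); apply: lmul_coef0.
by rewrite (@trunc_lmul _ _ _ _ k.+1)// (addrC N) (@trunc_lmul _ _ _ _ k.+1)// mulrC.
Qed.

Lemma lmulA : associative lmul.
Proof.
move=> x y z; have [N xN] := lcoefP x; have [M yM] := lcoefP y.
have [P zP] := lcoefP z.
have xyb := lmul_coef0 xN yM; have yzb := lmul_coef0 yM zP.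
apply/laurentP/(@bounded_aboveP _ _ (N + M + P)) => [||k] /=.
- by rewrite -(addrA N M P); apply: lmul_coef0.
- exact: lmul_coef0.
have tE u v A B : bounded_above u A -> bounded_above v B -> forall j, (j < k.+1)%N ->
    (trunc (lmul_coef u v) (A + B) k.+1)`_j = (trunc u A k.+1 * trunc v B k.+1)`_j.
  by move=> uA vB j jk; rewrite coef_trunc// (@trunc_lmul _ _ _ _ k.+1).
rewrite -(addrA N M P) (@trunc_lmul _ _ _ _ k.+1)// (addrA N M P) (@trunc_lmul _ _ _ _ k.+1)//.
transitivity ((trunc x N k.+1 * (trunc y M k.+1 * trunc z P k.+1))`_k).
  rewrite coefM [RHS]coefM; apply: eq_bigr => j _; rewrite tE//.
  by rewrite ltnS leq_subr.
rewrite mulrA coefM [RHS]coefM; apply: eq_bigr => j _.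
by rewrite tE// ltn_ord.
Qed.

Lemma lmul1l : left_id lone lmul.
Proof.
move=> x; apply/laurentP/funext => n /=; rewrite /lmul_coef.
rewrite (fsbigTE [fset (0 : int)]%fset) => [|i].
  by rewrite big_seq_fset1 eqxx mul1r subr0.
by rewrite inE => /negPf ->; rewrite mul0r.
Qed.

Lemma lmulDl : left_distributive lmul ladd.
Proof.
move=> x y z; have [N0 xN0] := lcoefP x; have [M0 yM0] := lcoefP y.
have [P zP] := lcoefP z; pose N := Num.max N0 M0.
have xN : bounded_above x N by apply: bounded_aboveW xN0; rewrite le_max lexx.
have yN : bounded_above y N.
  by apply: bounded_aboveW yM0; rewrite le_max lexx orbT.
have xyN : bounded_above (ladd x y) N.
  by move=> n Nn /=; rewrite xN// yN// addr0.
apply/laurentP/(@bounded_aboveP _ _ (N + P)) => [||k] /=.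
- exact: (@lmul_coef0 (ladd x y)).
- by move=> n Nn; rewrite !(@lmul_coef0 _ _ N P)// addr0.
rewrite (@lmul_coefE (ladd x y))// !lmul_coefE// -big_split/=.
by apply: eq_bigr => j _; rewrite mulrDl.
Qed.

Lemma lone_neq0 : lone != 0.
Proof.
apply/eqP => /(congr1 (fun x : laurent F => x 0)) /= /eqP.
by rewrite oner_eq0.
Qed.

HB.instance Definition _ := GRing.Zmodule_isComNzRing.Build (laurent F)
  lmulA lmulC lmul1l lmulDl lone_neq0.

Lemma laurent_top x : x != 0 -> exists2 N, x N != 0 & bounded_above x N.
Proof.
move=> x0; have [n xn] : exists n, x n != 0.
  apply: contrapT => /forallNP xz; case/eqP: x0; apply/laurentP/funext => n /=.
  by apply/eqP; apply: contrapT => /negP; apply: xz.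
have [N xN] := lcoefP x.
have nN : n <= N by rewrite leNgt; apply: contra_neqN xn => /xN.
have P0 : exists k : nat, x (N - k%:Z) != 0.
  by exists `|N - n|%N; rewrite (_ : N - _ = n)//; lia.
case: (ex_minnP P0) => k xk kmin; exists (N - k%:Z) => // m km.
have [Nm|mN] := ltP N m; first exact: xN.
apply/eqP; apply: contraT => xm; have := kmin `|N - m|%N.
rewrite (_ : N - _%:Z = m); last by lia.
by move=> /(_ xm); lia.
Qed.

Lemma laurent_invP x : x != 0 -> exists y, y * x = 1.
Proof.
move=> /laurent_top[N xN0 xN].
pose a (k : nat) := x (N - k%:Z).
have a0 : a 0%N != 0 by rewrite /a subr0.
pose next (s : seq F) : F :=
  - (a 0%N)^-1 * \sum_(j < size s) s`_j * a (size s - j)%N.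
pose fix g k := if k is k'.+1 then rcons (g k') (next (g k'))
                else [:: (a 0%N)^-1].
have sg k : size (g k) = k.+1 by elim: k => //= k IH; rewrite size_rcons IH.
pose b k := (g k)`_k.
have gb k j : (j <= k)%N -> (g k)`_j = b j.
  elim: k => [|k IH]; first by rewrite leqn0 => /eqP ->.
  rewrite leq_eqVlt => /orP[/eqP -> //|jk] /=.
  by rewrite nth_rcons sg jk IH.
have bS k : \sum_(j < k.+2) b j * a (k.+1 - j)%N = 0.
  rewrite big_ord_recr/= subnn {2}/b /= nth_rcons sg ltnn eqxx /next sg.
  rewrite mulrC mulrA mulrN divff// mulN1r; apply/eqP; rewrite subr_eq0.
  by apply/eqP/eq_bigr => j _; rewrite gb// -ltnS ltn_ord.
pose c (n : int) : F := if n <= - N then b `|- N - n|%N else 0.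
have cN : bounded_above c (- N) by move=> n; rewrite /c ltNge => /negPf ->.
have cb k : c (- N - k%:Z) = b k.
  by rewrite /c ifT; [congr b|]; lia.
exists (Laurent (ex_intro _ (- N) cN)).
apply/laurentP/(@bounded_aboveP _ _ 0) => [|n|k] /=.
- by rewrite -(addNr N); apply: lmul_coef0.
- by case: eqP => // ->; rewrite ltxx.
rewrite -{1}(addNr N) lmul_coefE//.
under eq_bigr do rewrite cb.
case: k => [|k]; first by rewrite big_ord1 /b/= mulVf.
by rewrite (bS k); case: eqP => //; lia.
Qed.

Definition linv x : laurent F :=
  if pselect (x != 0) is left x0 then projT1 (cid (laurent_invP x0)) else 0.

Lemma lmulVf x : x != 0 -> linv x * x = 1.
Proof.
by rewrite /linv; case: pselect => // x0 _; case: cid.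
Qed.

Lemma linv0 : linv 0 = 0.
Proof. by rewrite /linv; case: pselect => // h; have := h; rewrite eqxx. Qed.

HB.instance Definition _ :=
  GRing.ComNzRing_isField.Build (laurent F) lmulVf linv0.

End LaurentField.

Section ContinuedFraction.
Variable F : fieldType.
Implicit Types (p : {poly F}) (x : laurent F).

Definition lpoly_coef p (n : int) : F := if n is Posz k then p`_k else 0.

Lemma lpoly_subproof p : exists N, bounded_above (lpoly_coef p) N.
Proof.
exists (size p)%:Z => -[k|k]// kp; rewrite /lpoly_coef nth_default//.
by rewrite ltz_nat in kp; exact: ltnW.
Qed.

(* The embedding of F[t], with t the variable 'X, into F((t^-1)). *)
Definition lpoly p := Laurent (lpoly_subproof p).

Definition rational_laurent x :=
  exists p q : {poly F}, q != 0 /\ x = lpoly p / lpoly q.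

(* The result does not depend on the bound picked by [cid]: see [int_partE]. *)
Definition int_part x : {poly F} :=
  \poly_(k < `|projT1 (cid (lcoefP x))|.+1) x k%:Z.

Lemma int_partE x k : (int_part x)`_k = x k%:Z.
Proof.
rewrite /int_part coef_poly; case: cid => N xN /=; case: ltnP => // Nk.
by rewrite xN//; lia.
Qed.

Definition frac_part x : laurent F := x - lpoly (int_part x).

(* Only used on the elements of t^-1 F[[t^-1]]. *)
Definition gauss_map x : laurent F := if x == 0 then 0 else frac_part (1 / x).

Definition cf_quotient x (n : nat) : {poly F} :=
  if n is m.+1 then int_part (1 / iter m gauss_map (frac_part x))
  else int_part x.

Fixpoint cf_denom x (n : nat) : {poly F} :=
  match n with
  | 0 => 1
  | 1 => cf_quotient x 1
  | (m.+1 as m').+1 => cf_quotient x n * cf_denom x m' + cf_denom x m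
  end.

End ContinuedFraction.

Section Systems.
Context {d : measure_display} {X : measurableType d} {R : realType}.
Variable mu : probability X R.

(* Lebesgue measurable (not only Borel) subsets of the line. *)
Definition lebesgue_measurable (A : set R) :=
  measurable (A : set (caratheodory_type ((wlength (R:=R) idfun)^*)%mu)).

(* A complete probability space isomorphic mod 0 to [0, 1] with the
   Lebesgue sigma-algebra and measure. *)
Definition nonatomic_lebesgue_space :=
  measure_is_complete mu /\
  exists (X0 : set X) (Y0 : set R) (phi : X -> R),
    [/\ measurable X0 /\ mu (~` X0) = 0%E,
        [/\ Y0 `<=` `[0, 1]%classic, lebesgue_measurable Y0 &
            completed_lebesgue_measure (`[0, 1]%classic `\` Y0) = 0%E],
        set_bij X0 Y0 phi,
        (forall A, A `<=` X0 ->
           measurable A <-> lebesgue_measurable (phi @` A)) &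
        (forall A, A `<=` X0 -> measurable A ->
           mu A = completed_lebesgue_measure (phi @` A))].

Context {G : zmodType}.
Variable T : G -> X -> X.

Definition measure_preserving_action :=
  [/\ (forall x, T 0 x = x),
      (forall g h x, T (g + h) x = T g (T h x)),
      (forall g, measurable_fun [set: X] (T g)) &
      (forall g A, measurable A -> mu (T g @^-1` A) = mu A)].

Definition measure_preserving_system :=
  nonatomic_lebesgue_space /\ measure_preserving_action.

Definition free_action := forall g, g != 0 ->
  measurable [set x | T g x = x] /\ mu [set x | T g x = x] = 0%E.

Definition rigidity_sequence (a : nat -> G) :=
  forall f : X -> R, f \in Lfun mu 2%:E ->
    'N[mu]_2[(fun x => (f (T (a n) x) - f x)%:E)]%E @[n --> \oo] --> 0%E.

Definition symdiff (A B : {fset G}) : {fset G} :=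
  ((A `\` B) `|` (B `\` A))%fset.

Definition folner (Phi : nat -> {fset G}) :=
  (forall N, Phi N != fset0) /\
  forall x : G,
    #|` symdiff ([fset (g + x)%R | g in Phi N]%fset) (Phi N)|%:R / #|` Phi N|%:R
      @[N --> \oo] --> (0 : R).

Definition weakly_mixing := forall A B, measurable A -> measurable B ->
  forall Phi, folner Phi ->
    #|` Phi N|%:R^-1 * (\sum_(g <- Phi N)
        `|fine (mu (A `&` T g @` B)) - fine (mu A) * fine (mu B)|)
      @[N --> \oo] --> (0 : R).

End Systems.

(* Main.v *)
From HB Require Import structures.
Require Import Defs.
From mathcomp Require Import all_boot all_order all_algebra finmap.
From mathcomp Require Import zify ring lra.
From mathcomp Require Import all_classical all_reals all_analysis.
From mathcomp Require Import measurable_realfun.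
Set Implicit Arguments.
Unset Strict Implicit.
Unset Printing Implicit Defensive.
Import Order.TTheory GRing.Theory Num.Theory.
Import numFieldNormedType.Exports.
Local Open Scope classical_set_scope.
Local Open Scope ring_scope.

(* Write q for the cardinality of F.  Since the degrees of the denominators q_n
   are strictly increasing, there is a degree preserving automorphism L of the
   group F[t] with L(q_n) = t^(deg q_n).  So one needs a free weakly mixing action
   of the group of finitely supported sequences over F along which the standard
   basis tends to the identity.

   Let G_(k+1) = G_k x G_k x E_k, where the sizes of the finite vector spaces E_k
   tend to infinity while the sum of their inverses diverges, and let
   G_(k+1) -> G_k map (x, w, e) to x - w if e = 0 and to x otherwise.  This map is
   equivariant under translations by G_k, and so the union of the groups G_k acts
   on the inverse limit of the sets G_k, with its uniform measure.
   - Free: G_k acts on the k-th coordinate by translations.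
   - Rigid: a translation by a vector of the new part G_k x E_k changes the k-th
     coordinate with probability at most 2 / |E_k|.
   - Weakly mixing: if u and v are functions on G_k and u has mean 0, then
     translating by (h, w, e) with e <> 0 in G_(k+1) multiplies the correlation
     of u and v at h by 1 - 2 / |E_k|.  Hence the mean over G_k of the absolute
     value of the correlation tends to 0, and the mean over a translate of G_k is
     not larger.
   The inverse limit is realised on [0, 1[, partitioned at level k into |G_k|
   intervals of equal length indexed by G_k, and the action is by finite interval
   exchanges. *)

(** * Correlations on finite groups *)

Section RowBlocks.
Variables (F : finFieldType) (V : nmodType).

Lemma sum_row_mx n m (G : 'rV[F]_(n + m) -> V) :
  \sum_z G z = \sum_w \sum_e G (row_mx w e).
Proof.
rewrite pair_big /= (reindex (fun p : 'rV[F]_n * 'rV[F]_m => row_mx p.1 p.2)) //=.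
exists (fun z => (lsubmx z, rsubmx z)) => [[w e] _|z _] /=.
  by rewrite row_mxKl row_mxKr.
by rewrite hsubmxK.
Qed.

End RowBlocks.

Section Bonding.
Variables (F : finFieldType) (n r : nat).

Definition twist (z : 'rV[F]_(n + r)) : 'rV[F]_n :=
  if rsubmx z == 0 then lsubmx z else 0.

(** The bonding map from G_(k+1) to G_k: a row of length [n + (n + r)] is read as the three blocks
    (x, w, e). *)
Definition bond (x : 'rV[F]_(n + (n + r))) : 'rV[F]_n :=
  lsubmx x - twist (rsubmx x).

Lemma bond_row_mx (x : 'rV[F]_n) z : bond (row_mx x z) = x - twist z.
Proof. by rewrite /bond row_mxKl row_mxKr. Qed.

End Bonding.

Section Correlation.
Variables (R : realFieldType) (F : finFieldType).

(** Not normalised: dividing by the order of the group gives the integral of [v] against the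
    translate of [u]. *)
Definition corr n (u v : 'rV[F]_n -> R) h := \sum_x u (x - h) * v x.

Lemma sum_corr n (u v : 'rV[F]_n -> R) :
  \sum_h corr u v h = (\sum_x u x) * (\sum_x v x).
Proof.
rewrite exchange_big/= mulr_sumr; apply: eq_bigr => x _; rewrite -mulr_suml.
congr (_ * _); rewrite (reindex_inj (h := fun h => x - h)) /=.
  by apply: eq_bigr => h _; rewrite opprB addrCA subrr addr0.
by move=> a b /addrI/oppr_inj.
Qed.

Variables (n r : nat) (u v : 'rV[F]_n -> R).
Local Notation D := #|{: 'rV[F]_(n + r)}|.
Local Notation W := #|{: 'rV[F]_n}|.
Local Notation E := #|{: 'rV[F]_r}|.

(** For fixed [z] the map [bond] is a translation of the first block, so substituting [x + twist z]
    for [x] leaves a correlation on the smaller group, at an argument shifted by the two twists. *)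
Lemma corr_bond h d :
  corr (u \o @bond F n r) (v \o @bond F n r) (row_mx h d) =
  \sum_z corr u v (h + twist (z - d) - twist z).
Proof.
rewrite /corr sum_row_mx exchange_big; apply: eq_bigr => z _.
rewrite (reindex_inj (addIr (twist z))); apply: eq_bigr => x _ /=.
rewrite opp_row_mx add_row_mx !bond_row_mx addrK.
by congr (u _ * _); rewrite !opprD opprK !addrA (addrAC x) [LHS]addrAC.
Qed.

Definition corr_mass n (u v : 'rV[F]_n -> R) := \sum_h `|corr u v h|.

Lemma corr_mass_ge0 : 0 <= corr_mass u v.
Proof. by apply: sumr_ge0. Qed.

Lemma shift_corr_mass g : \sum_h `|corr u v (h + g)| = corr_mass u v.
Proof. by rewrite /corr_mass [RHS](reindex_inj (addIr g)). Qed.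

Hypothesis u0 : \sum_x u x = 0.

(* The blocks [rsubmx z = 0] and [rsubmx z = rsubmx d], where the twists of [z] or
   of [z - d] are not 0, contribute full sums of [corr u v], which vanish; on the
   remaining [z] the correlation is unchanged. *)
Lemma corr_bond_free h d : rsubmx d != 0 ->
  corr (u \o @bond F n r) (v \o @bond F n r) (row_mx h d) =
  (D%:R - 2 * W%:R) * corr u v h.
Proof.
move=> d0; rewrite corr_bond.
have c0 : \sum_h corr u v h = 0 by rewrite sum_corr u0 mul0r.
have c1 : \sum_w corr u v (h - w) = 0.
  rewrite -[RHS]c0 [RHS](reindex_inj (h := fun w => h - w))//.
  by move=> a b /addrI/oppr_inj.
have c2 : \sum_w corr u v (h + (w - lsubmx d)) = 0.
  rewrite -[RHS]c0 [RHS](reindex_inj (h := fun w => h + (w - lsubmx d)))//.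
  by move=> a b /addrI/addIr.
have pw z : corr u v (h + twist (z - d) - twist z) = corr u v h +
    (if rsubmx z == 0 then corr u v (h - lsubmx z) - corr u v h else 0) +
    (if rsubmx z == rsubmx d
     then corr u v (h + (lsubmx z - lsubmx d)) - corr u v h else 0).
  rewrite /twist !linearB/= subr_eq0; case: eqP => [-> /=|zd].
    by rewrite (negPf d0) subr0; ring.
  by case: eqP => [ze|_]; rewrite !addr0 ?subr0//; ring.
rewrite (eq_bigr _ (fun z _ => pw z)) !big_split/= sumr_const.
rewrite (sum_row_mx (fun z => if rsubmx z == 0 then _ else _)).
rewrite (sum_row_mx (fun z => if rsubmx z == _ then _ else _)).
rewrite [X in _ + X + _](_ : _ = - (W%:R * corr u v h)); last first.
  under eq_bigr => w _ do under eq_bigr => e _ do rewrite row_mxKl row_mxKr.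
  under eq_bigr => w _ do rewrite -big_mkcond big_pred1_eq.
  by rewrite big_split/= c1 add0r sumr_const mulNrn mulr_natl.
rewrite [X in _ + X](_ : _ = - (W%:R * corr u v h)); last first.
  under eq_bigr => w _ do under eq_bigr => e _ do rewrite row_mxKl row_mxKr.
  under eq_bigr => w _ do rewrite -big_mkcond big_pred1_eq.
  by rewrite big_split/= c2 add0r sumr_const mulNrn mulr_natl.
by rewrite -mulr_natl; ring.
Qed.

(** The crude estimate, for the [d] whose last block is 0: by [corr_bond] each of the [D] values of
    [z] contributes at most the mass of a translated correlation. *)
Lemma corr_mass_bond_le d :
  \sum_h `|corr (u \o @bond F n r) (v \o @bond F n r) (row_mx h d)| <=
  D%:R * corr_mass u v.
Proof.
under eq_bigr => h _ do rewrite corr_bond.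
apply: le_trans (ler_sum _ (fun h _ => ler_norm_sum _ _ _)) _.
rewrite exchange_big/= (eq_bigr (fun=> corr_mass u v)); last first.
  move=> z _; rewrite -(shift_corr_mass (twist (z - d) - twist z)).
  by apply: eq_bigr => h _; rewrite addrA.
by rewrite sumr_const mulr_natl.
Qed.

(** Of the [E] possible last blocks, all but 0 gain the factor [D - 2 W] of [corr_bond_free], and
    the block 0 costs at most [D]. *)
Lemma corr_mass_bond : (0 < r)%N ->
  corr_mass (u \o @bond F n r) (v \o @bond F n r) <=
  D%:R ^+ 2 * (1 - E%:R^-1) * corr_mass u v.
Proof.
move=> r0; rewrite {1}/corr_mass sum_row_mx exchange_big/= sum_row_mx.
have DWE : D = (W * E)%N by rewrite !card_mx !mul1n expnD.
have E2 : (2 <= E)%N.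
  rewrite card_mx mul1n; apply: leq_trans (card_finNzRing_gt1 F) _.
  by rewrite -{1}(expn1 #|F|) leq_pexp2l// ltnW// card_finNzRing_gt1.
have W0 : (0 < W)%N by rewrite card_mx expn_gt0 (ltnW (card_finNzRing_gt1 F)).
have E2' : 2 <= E%:R :> R by rewrite ler_nat.
have W0' : 0 < W%:R :> R by rewrite ltr0n.
have m0 := corr_mass_ge0.
pose B (e : 'rV[F]_r) : R := if e == 0 then D%:R * corr_mass u v
  else (D%:R - 2 * W%:R) * corr_mass u v.
apply: (@le_trans _ _ (\sum_(w : 'rV[F]_n) \sum_e B e)).
  apply: ler_sum => w _; apply: ler_sum => e _; rewrite /B.
  case: eqP => [_|/eqP e0]; first exact: corr_mass_bond_le.
  rewrite (eq_bigr (fun h => (D%:R - 2 * W%:R) * `|corr u v h|)).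
    by rewrite -mulr_sumr.
  move=> h _; rewrite corr_bond_free ?row_mxKr// normrM ger0_norm//.
  by rewrite subr_ge0 -natrM ler_nat DWE mulnC leq_mul.
rewrite sumr_const (bigD1 0)//= /B eqxx.
rewrite (eq_bigr (fun=> (D%:R - 2 * W%:R) * corr_mass u v)); last first.
  by move=> e /negPf ->.
rewrite sumr_const cardC1 -[leLHS]mulr_natl -[X in _ * (_ + X) <= _]mulr_natl -subn1 natrB ?(leq_trans _ E2)//.
rewrite DWE natrM.
move: (E%:R : R) (W%:R : R) (corr_mass u v : R) E2' W0' m0 => e w c e2 w0 c0.
rewrite [leRHS](_ : _ = w ^+ 2 * e * (e - 1) * c); last first.
  by field; rewrite gt_eqF// (lt_le_trans _ e2).
(* With D = W E the total is W^2 (E + (E - 1)(E - 2)) times the old mass, which is below the claimed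
   bound by W^2 (E - 2) times that mass; hence the need for E >= 2. *)
rewrite -subr_ge0 [leRHS](_ : _ = w ^+ 2 * (e - 2) * c); last by ring.
by rewrite !mulr_ge0// ?subr_ge0// ltW.
Qed.

End Correlation.

(** * The tower of finite groups *)

Section Levels.
Variable F : finFieldType.
Local Notation q := #|F|.

Let q_gt1 : (1 < q)%N. Proof. exact: card_finNzRing_gt1. Qed.

(* [q ^ rdim k] tends to infinity, but so slowly that the sum of its inverses
   diverges. *)
Definition rdim k := trunc_log q (k + q).

Lemma rdim_gt0 k : (0 < rdim k)%N.
Proof. by rewrite trunc_log_gt0 q_gt1; lia. Qed.

Lemma rdim_le k : (q ^ rdim k <= k + q)%N.
Proof. by apply: trunc_logP => //; lia. Qed.

Lemma rdim_gt k : (k + q < q ^ (rdim k).+1)%N.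
Proof. exact: trunc_log_ltn. Qed.

Fixpoint ldim k := if k is k'.+1 then (ldim k' + (ldim k' + rdim k'))%N else 0%N.

Lemma ldim_homo : {homo ldim : i j / (i <= j)%N}.
Proof. by apply: homo_leq => // [i|i]; [exact: leq_trans|rewrite leq_addr]. Qed.

(** Hence a polynomial [g] always fits into the group of level [size g]. *)
Lemma leq_ldim k : (k <= ldim k)%N.
Proof.
elim: k => //= k IH; rewrite addnA -addn1 leq_add ?rdim_gt0//.
by rewrite (leq_trans IH)// leq_addr.
Qed.

Local Notation Gam k := 'rV[F]_(ldim k).

Definition lbond k : Gam k.+1 -> Gam k := @bond F (ldim k) (rdim k).

(** Composition with [j] bonding maps. Levels are written [j + m] so that recursion on [j] needs no
    casts between the row types. *)
Fixpoint pull (T : Type) (m : nat) (u : Gam m -> T) j : Gam (j + m) -> T :=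
  
  if j is i.+1 return Gam (j + m) -> T then @pull T m u i \o @lbond (i + m) else u.

Arguments pull {T m} u j.

Lemma card_Gam k : #|{: Gam k}| = (q ^ ldim k)%N.
Proof. by rewrite card_mx mul1n. Qed.

Lemma card_Gam_gt0 k : (0 < #|{: Gam k}|)%N.
Proof. by rewrite card_Gam expn_gt0 ltnW. Qed.

Lemma card_GamS k : #|{: Gam k.+1}| =
  (#|{: Gam k}| * #|{: 'rV[F]_(ldim k + rdim k)}|)%N.
Proof. by rewrite !card_mx !mul1n /= expnD. Qed.

(** The fibres of [lbond] have equal size, since for fixed [z] it translates the first block. *)
Lemma sum_lbond (V : nmodType) k (G : Gam k -> V) :
  \sum_y G (lbond y) = (\sum_x G x) *+ #|{: 'rV[F]_(ldim k + rdim k)}|.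
Proof.
rewrite sum_row_mx exchange_big/= -sumr_const; apply: eq_bigr => z _.
rewrite (reindex_inj (addIr (twist z))); apply: eq_bigr => x _.
by rewrite /lbond bond_row_mx addrK.
Qed.

Section Mixing.
Variable R : realFieldType.
Implicit Types m k : nat.

Lemma sum_lift0 m (u : Gam m -> R) j :
  \sum_x u x = 0 -> \sum_y pull u j y = 0.
Proof.
move=> u0; elim: j => //= j IH.
by rewrite (sum_lbond (pull u j)) IH mul0rn.
Qed.

(** Passing from level k to k + 1 multiplies the normalised mass by at most 1 - 1 / |E_k| <= (k + q
    - 1) / (k + q), because |E_k| <= k + q; these factors telescope. *)
Lemma corr_mass_lift m (u v : Gam m -> R) j : \sum_x u x = 0 ->
  corr_mass (pull u j) (pull v j) / #|{: Gam (j + m)}|%:R ^+ 2 <=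
  (m + q.-1)%:R / (j + m + q.-1)%:R * (corr_mass u v / #|{: Gam m}|%:R ^+ 2).
Proof.
move=> u0; elim: j => [|j IH].
  by rewrite /= divff ?mul1r// pnatr_eq0; move: q_gt1; case: #|F| => [|[|a]]; lia.
set k := (j + m)%N in IH *.
have D0 : 0 < #|{: 'rV[F]_(ldim k + rdim k)}|%:R :> R.
  by rewrite card_mx ltr0n expn_gt0 ltnW.
have W0 : 0 < #|{: Gam k}|%:R :> R by rewrite ltr0n card_Gam_gt0.
have := corr_mass_bond (pull v j) (sum_lift0 j u0) (rdim_gt0 k).
rewrite -/(corr_mass (pull u j.+1) (pull v j.+1)).
have -> : corr_mass (pull u j \o @bond F (ldim k) (rdim k))
  (pull v j \o @bond F (ldim k) (rdim k)) =
  corr_mass (pull u j.+1) (pull v j.+1) by [].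
have E0 : 0 < #|{: 'rV[F]_(rdim k)}|%:R :> R.
  by rewrite card_mx ltr0n expn_gt0 ltnW.
have Ek : #|{: 'rV[F]_(rdim k)}|%:R <= (k + q)%:R :> R.
  by rewrite ler_nat card_mx mul1n rdim_le.
have kq : (k.+1 + q.-1)%:R = (k + q)%:R :> R.
  by congr (_%:R); move: q_gt1; case: #|F| => [|[|a]]; lia.
have kq1 : (k + q.-1)%:R = (k + q)%:R - 1 :> R.
  rewrite -[X in _ = _ - X]/(1%:R) -natrB; move: q_gt1; case: #|F| => [|[|a]]; try lia.
  by move=> _; congr (_%:R); lia.
have kq2 : 2 <= (k + q)%:R :> R by rewrite ler_nat; move: q_gt1; case: #|F| => [|[|a]]; lia.
have mq : 0 <= (m + q.-1)%:R :> R by [].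
rewrite -[(j.+1 + m)%N]/k.+1 card_GamS natrM kq kq1 in IH *.
have m0 := corr_mass_ge0 (pull u j) (pull v j).
move: D0 W0 E0 Ek kq2 mq IH m0.
move: (corr_mass u v / _) => M.
move: (#|{: 'rV[F]_(ldim k + rdim k)}|%:R : R) (#|{: Gam k}|%:R : R).
move: (#|{: 'rV[F]_(rdim k)}|%:R : R) ((k + q)%:R : R) ((m + q.-1)%:R : R).
move: (corr_mass (pull u j) (pull v j) : R) (corr_mass (pull u j.+1) (pull v j.+1) : R).
move=> X Y e s t D W D0 W0 e0 es s2 t0 IH X0 XY.
rewrite ler_pdivrMr ?exprn_gt0 ?mulr_gt0//; apply: (le_trans XY).
have X1 : X <= t / (s - 1) * M * W ^+ 2 by rewrite -ler_pdivrMr// exprn_gt0.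
have es' : 1 - e^-1 <= 1 - s^-1 by rewrite lerB// lef_pV2// posrE (lt_le_trans _ es).
apply: (@le_trans _ _ (D ^+ 2 * (1 - s^-1) * X)).
  by rewrite ler_wpM2r// ler_wpM2l// sqr_ge0.
have s1 : 0 <= 1 - s^-1 by rewrite subr_ge0 invf_le1; lra.
apply: (@le_trans _ _ (D ^+ 2 * (1 - s^-1) * (t / (s - 1) * M * W ^+ 2))).
  by rewrite ler_wpM2l// mulr_ge0// sqr_ge0.
rewrite le_eqVlt; apply/orP; left; apply/eqP; field.
by apply/andP; split; lra.
Qed.

(** The inclusion of the group G_K into G_(j+K), along which the acting group is the union of the
    G_k. *)
Fixpoint emb (K : nat) (x : Gam K) j : Gam (j + K) :=
  if j is i.+1 return Gam (j + K) then row_mx (@emb K x i) 0 else x.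

Arguments emb {K} x j.

(** The mean over a translate of G_K at a higher level is at most the full mean at level K: by
    [corr_bond], each step up turns a correlation into a sum over [z] of correlations one level
    below, whose arguments again run through a translate of the image of G_K. *)
Lemma sum_corr_emb K (u v : Gam K -> R) j y :
  (\sum_x `|corr (pull u j) (pull v j) (y + emb x j)|) / #|{: Gam (j + K)}|%:R <=
  corr_mass u v / #|{: Gam K}|%:R.
Proof.
elim: j y => [|j IH] y.
  rewrite /= /corr_mass [in leRHS](reindex_inj (addrI y))//.
set k := (j + K)%N.
have D0 : 0 < #|{: 'rV[F]_(ldim k + rdim k)}|%:R :> R.
  by rewrite card_mx ltr0n expn_gt0 ltnW.
have W0 : 0 < #|{: Gam k}|%:R :> R by rewrite ltr0n card_Gam_gt0.
have -> : \sum_x `|corr (pull u j.+1) (pull v j.+1) (y + emb x j.+1)| =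
  \sum_x `|\sum_z corr (pull u j) (pull v j)
     (lsubmx y + twist (z - rsubmx y) - twist z + emb x j)|.
  apply: eq_bigr => x _; congr `|_|.
  rewrite -{1}[y](@hsubmxK _ 1 (ldim k) (ldim k + rdim k)) [emb x j.+1]/= add_row_mx addr0.
  rewrite corr_bond; apply: eq_bigr => z _; congr corr.
  by rewrite (addrAC (lsubmx y)) [LHS]addrAC.
rewrite -[(j.+1 + K)%N]/k.+1 card_GamS natrM invfM mulrA ler_pdivrMr//.
apply: le_trans (ler_wpM2r _ (ler_sum _ (fun h _ => ler_norm_sum _ _ _))) _.
  by rewrite invr_ge0 ltW.
rewrite exchange_big/= mulr_suml.
apply: (@le_trans _ _ (\sum_(z : 'rV[F]_(ldim k + rdim k))
  corr_mass u v / #|{: Gam K}|%:R)); last by rewrite sumr_const mulr_natr.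
by apply: ler_sum => z _; apply: IH.
Qed.

(** The first [i] levels make the mean small; the further [j] levels only make room for an arbitrary
    [y], with a bound that does not depend on [j]. *)
Lemma sum_corr_le m (u v : Gam m -> R) i j y : \sum_x u x = 0 ->
  (\sum_x `|corr (pull (pull u i) j) (pull (pull v i) j) (y + emb x j)|) /
    #|{: Gam (j + (i + m))}|%:R / #|{: Gam (i + m)}|%:R <=
  (m + q.-1)%:R / (i + m + q.-1)%:R * (corr_mass u v / #|{: Gam m}|%:R ^+ 2).
Proof.
move=> u0; apply: le_trans (corr_mass_lift v i u0).
rewrite expr2 invfM mulrA ler_wpM2r ?invr_ge0//; exact: sum_corr_emb.
Qed.

End Mixing.
End Levels.

Arguments pull {F T m} u j.
Arguments emb {F K} x j.

(** * The interval exchanges *)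

Section BondTranslate.
Variables (F : finFieldType) (n r : nat).
Implicit Types (x : 'rV[F]_(n + (n + r))) (h : 'rV[F]_n).

Lemma rsubmx_translate x h : rsubmx (x + row_mx h 0) = rsubmx x.
Proof. by rewrite -[x]hsubmxK add_row_mx addr0 !row_mxKr. Qed.

(** The equivariance that makes the translations of G_k compatible between levels. *)
Lemma bond_translate x h : bond (x + row_mx h 0) = bond x + h.
Proof.
by rewrite -[x]hsubmxK add_row_mx addr0 !bond_row_mx addrAC.
Qed.

End BondTranslate.

Section Cells.
Variable F : finFieldType.
Local Notation q := #|F|.
Local Notation Gam k := 'rV[F]_(ldim F k).
Local Notation Inc k := 'rV[F]_(ldim F k + rdim F k).

(* The lexicographic numbering: the cells of level [k.+1] refine those of level
   [k] along [lbond]. *)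
Fixpoint rank (k : nat) : Gam k -> nat :=
  if k is i.+1 return Gam k -> nat
  then fun x => (@rank i (lbond x) * #|{: Inc i}| + enum_rank (rsubmx x : Inc i))%N
  else fun=> 0%N.

Lemma rank_lt k (x : Gam k) : (rank x < #|{: Gam k}|)%N.
Proof.
elim: k x => [|k IH] x; first by rewrite card_mx mul1n.
rewrite card_GamS /=.
have := IH (lbond x); have := ltn_ord (enum_rank (rsubmx x : Inc k)).
set a := rank _; set b := #|_|; set c := #|_|; move: (nat_of_ord _) => e eb ac.
apply: (@leq_trans (a.+1 * b)); first by rewrite mulSn addnC ltn_add2r.
by rewrite leq_pmul2r// (leq_ltn_trans _ eb).
Qed.

(** Quotient and remainder by the size of the new blocks recover [lbond x] and [rsubmx x]; these
    determine [x] because the twist depends on [rsubmx x] alone. *)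
Lemma rank_inj k : injective (@rank k).
Proof.
elim: k => [|k IH] x y; first by rewrite !thinmx0.
rewrite /= => e.
have D0 : (0 < #|{: Inc k}|)%N by apply/card_gt0P; exists 0.
have e1 := congr1 (divn^~ #|{: Inc k}|) e; have e2 := congr1 (modn^~ #|{: Inc k}|) e.
move: e1 e2 => /=; rewrite !divnMDl// !modnMDl !modn_small// !divn_small// !addn0.
move=> /IH e1 /ord_inj/enum_rank_inj e2.
have {}e1 : lsubmx x = lsubmx y :> Gam k.
  by move: e1; rewrite /lbond /bond e2 => /addIr.
by rewrite -[x](@hsubmxK _ 1 (ldim F k)) -[y](@hsubmxK _ 1 (ldim F k)) e1 e2.
Qed.

(* Junk value 0 when [i] is out of range. *)
Definition code k i : Gam k := odflt 0 [pick x | rank x == i].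

Lemma rankK k : cancel (@rank k) (@code k).
Proof.
move=> x; rewrite /code; case: pickP => /= [y /eqP/rank_inj//|/(_ x)].
by rewrite eqxx.
Qed.

Lemma codeK k i : (i < #|{: Gam k}|)%N -> rank (code k i) = i.
Proof.
move=> ik; pose f (x : Gam k) := Ordinal (rank_lt x).
have fI : injective f by move=> x y /(congr1 val)/rank_inj.
have [g _ gK] := inj_card_bij fI (eq_leq (card_ord _)).
have := congr1 val (gK (Ordinal ik)) => /= <-.
by rewrite rankK.
Qed.

Variable R : realType.
Implicit Types x y : R.
Local Notation M k := (#|{: Gam k}|%:R : R).

Lemma natr_card_Gam_gt0 k : 0 < M k.
Proof. by rewrite ltr0n card_Gam_gt0. Qed.

Definition cell k x : Gam k := code k (Num.trunc (M k * x)).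

Lemma rank_cell k x : 0 <= x < 1 -> rank (cell k x) = Num.trunc (M k * x).
Proof.
move=> /andP[x0 x1]; rewrite codeK// -(ltr_nat R).
have Mx0 : 0 <= M k * x by rewrite mulr_ge0.
have /andP[+ _] := trunc_itv Mx0 => /le_lt_trans; apply.
by rewrite -[ltRHS]mulr1 ltr_pM2l// natr_card_Gam_gt0.
Qed.

Lemma cell_itv k x : 0 <= x < 1 ->
  (rank (cell k x))%:R <= M k * x < (rank (cell k x)).+1%:R.
Proof.
move=> x01; rewrite rank_cell// trunc_itv// mulr_ge0//.
by case/andP: x01.
Qed.

Lemma cellP k x v : 0 <= x < 1 ->
  cell k x = v <-> (rank v)%:R <= M k * x < (rank v).+1%:R.
Proof.
move=> x01; split=> [<-|vx]; first exact: cell_itv.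
by rewrite /cell (trunc_def vx) rankK.
Qed.

(** Dividing the rank at level k + 1 by the size of the new blocks gives the rank at level k, so the
    intervals are nested and a point of [0, 1[ yields a thread of the inverse system. *)
Lemma cell_bond k x : 0 <= x < 1 -> lbond (cell k.+1 x) = cell k x.
Proof.
move=> x01; apply/esym/cellP => //; have := cell_itv k.+1 x01.
rewrite card_GamS natrM /=; set a := rank _; set b := #|{: Inc k}|.
have := ltn_ord (enum_rank (rsubmx (cell k.+1 x) : Inc k)); rewrite -/b.
move: (nat_of_ord _) => e eb /andP[l u].
have b0 : 0 < b%:R :> R by rewrite ltr0n (leq_ltn_trans _ eb).
rewrite -(ler_pM2r b0) -(ltr_pM2r b0) -!natrM mulrAC.
apply/andP; split.
  by apply: le_trans l; rewrite ler_nat leq_addr.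
by apply: lt_le_trans u _; rewrite ler_nat mulSn addnC ltn_add2r.
Qed.

Lemma pull_cell T m (u : Gam m -> T) j x : 0 <= x < 1 ->
  pull u j (cell (j + m) x) = u (cell m x).
Proof.
move=> x01; elim: j => //= j <-.
by rewrite (cell_bond _ x01).
Qed.

(* [L] replaces the coefficients of a polynomial by its coordinates in a basis
   with one element of each degree. *)
Variable L : {poly F} -> {poly F}.
Hypothesis LD : {morph L : p r / p + r}.
Hypothesis size_L : forall p, size (L p) = size p.
Hypothesis L_surj : forall p, exists r, L r = p.
Implicit Types g h : {poly F}.

(** A truncation in general; it represents [g] faithfully only if [size g <= ldim F k]. *)
Definition gcoord k g : Gam k := poly_rV (L g).

Lemma gcoordD k g h : gcoord k (g + h) = gcoord k g + gcoord k h.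
Proof. by rewrite /gcoord LD linearD. Qed.

Lemma gcoord0 k : gcoord k 0 = 0.
Proof. by apply: (addrI (gcoord k 0)); rewrite -gcoordD !addr0. Qed.

Lemma gcoordN k g : gcoord k (- g) = - gcoord k g.
Proof. by apply: (addrI (gcoord k g)); rewrite -gcoordD !subrr gcoord0. Qed.

Lemma lsubmx_gcoord k g : lsubmx (gcoord k.+1 g) = gcoord k g :> Gam k.
Proof. by apply/rowP => i; rewrite !mxE. Qed.

Lemma rsubmx_gcoord k g : (size g <= ldim F k)%N ->
  rsubmx (gcoord k.+1 g) = 0 :> Inc k.
Proof.
move=> gk; apply/rowP => i; rewrite !mxE nth_default//= size_L (leq_trans gk)//.
exact: leq_addr.
Qed.

Lemma gcoordS k g : (size g <= ldim F k)%N -> gcoord k.+1 g = row_mx (gcoord k g) 0.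
Proof.
move=> gk; rewrite -[LHS](@hsubmxK _ 1 (ldim F k) (ldim F k + rdim F k)).
by rewrite lsubmx_gcoord rsubmx_gcoord.
Qed.

Lemma gcoord_eq0 k g : (size g <= ldim F k)%N -> gcoord k g = 0 -> g = 0.
Proof.
move=> gk /(congr1 rVpoly); rewrite /gcoord poly_rV_K ?size_L// linear0 => Lg0.
by apply/eqP; rewrite -size_poly_eq0 -size_L Lg0 size_poly0.
Qed.

Lemma gcoord_surj k (v : Gam k) :
  exists2 g : {poly F}, (size g <= ldim F k)%N & gcoord k g = v.
Proof.
have [g gE] := L_surj (rVpoly v); exists g; last by rewrite /gcoord gE rVpolyK.
by rewrite -size_L gE size_poly.
Qed.

Lemma gcoord_emb k g j : (size g <= ldim F k)%N ->
  gcoord (j + k) g = emb (gcoord k g) j.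
Proof.
move=> gk; elim: j => //= j <-.
by apply: gcoordS; apply: leq_trans gk _; apply: ldim_homo; apply: leq_addl.
Qed.

(** The displacement between the left endpoints of the interval of [x] and of the interval with the
    translated index. *)
Definition jump k g x : R :=
  ((rank (cell k x + gcoord k g))%:R - (rank (cell k x))%:R) / M k.

(** A translation by an old vector keeps the new blocks, so the position of a small interval inside
    the larger one is unchanged and cancels in the difference of ranks. *)
Lemma jumpS k g x : 0 <= x < 1 -> (size g <= ldim F k)%N ->
  jump k.+1 g x = jump k g x.
Proof.
move=> x01 gk; rewrite /jump (gcoordS gk) /= rsubmx_translate.
rewrite -(cell_bond k x01) {1}/lbond bond_translate card_GamS !natrD !natrM.
rewrite opprD addrACA subrr addr0 -mulrBl -mulf_div divff ?mulr1//.
by rewrite pnatr_eq0 -lt0n; apply/card_gt0P; exists 0.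
Qed.

Lemma jump_eq j k g x : 0 <= x < 1 -> (size g <= ldim F k)%N ->
  (size g <= ldim F j)%N -> jump j g x = jump k g x.
Proof.
move=> x01.
wlog jk : j k / (j <= k)%N.
  by move=> H gk gj; case: (leqP j k) => [/H|/ltnW/H H1]; [exact|rewrite H1].
rewrite -(subnK jk); move: (k - j)%N => i _ gj; elim: i => //= i IH.
rewrite jumpS// (leq_trans gj)// ldim_homo// leq_addl//.
Qed.

(* Any level [k] with [size g <= ldim F k] gives the same map: see [exchE]. *)
Definition exch g x : R := if 0 <= x < 1 then x + jump (size g) g x else x.

Lemma exchE k g x : 0 <= x < 1 -> (size g <= ldim F k)%N ->
  exch g x = x + jump k g x.
Proof.
by move=> x01 gk; rewrite /exch x01 (jump_eq x01 gk)// leq_ldim.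
Qed.

Lemma exch_out g x : ~~ (0 <= x < 1) -> exch g x = x.
Proof. by rewrite /exch => /negPf ->. Qed.

Lemma exch_itv k g x : 0 <= x < 1 -> (size g <= ldim F k)%N ->
  (rank (cell k x + gcoord k g))%:R <= M k * exch g x
    < (rank (cell k x + gcoord k g)).+1%:R.
Proof.
move=> x01 gk; rewrite (exchE x01 gk) mulrDr (_ : M k * jump k g x =
  (rank (cell k x + gcoord k g))%:R - (rank (cell k x))%:R); last first.
  by rewrite /jump mulrCA divff ?mulr1// gt_eqF// natr_card_Gam_gt0.
have := cell_itv k x01.
by move: (rank _) (rank _) (_ * _) => a b c; rewrite -!natr1; lra.
Qed.

Lemma exch01 g x : (0 <= exch g x < 1) = (0 <= x < 1).
Proof.
have [x01|x01] := boolP (0 <= x < 1); last by rewrite exch_out// (negPf x01).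
have /andP[l u] := exch_itv x01 (leq_ldim F (size g)).
rewrite -(pmulr_rge0 _ (natr_card_Gam_gt0 (size g))) (le_trans _ l)//=.
rewrite -(ltr_pM2l (natr_card_Gam_gt0 (size g))) mulr1 (lt_le_trans u)// ler_nat.
exact: rank_lt.
Qed.

Lemma cell_exch k g x : 0 <= x < 1 -> (size g <= ldim F k)%N ->
  cell k (exch g x) = cell k x + gcoord k g.
Proof.
by move=> x01 gk; apply/cellP; [rewrite exch01|exact: exch_itv].
Qed.

Lemma exch0 x : exch 0 x = x.
Proof. by rewrite /exch /jump gcoord0 addr0 subrr mul0r addr0 if_same. Qed.

Lemma exchD g h x : exch (g + h) x = exch g (exch h x).
Proof.
have [x01|x01] := boolP (0 <= x < 1); last first.
  by rewrite (exch_out h x01) !exch_out.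
(* A common level at which all three exchanges are given by translations of the index. *)
pose k := maxn (size g) (size h).
have kk := leq_ldim F k.
have gk : (size g <= ldim F k)%N by rewrite (leq_trans (leq_maxl _ _) kk).
have hk : (size h <= ldim F k)%N by rewrite (leq_trans (leq_maxr _ _) kk).
have ghk : (size (g + h)%R <= ldim F k)%N by rewrite (leq_trans (size_polyD _ _) kk).
have y01 : 0 <= exch h x < 1 by rewrite exch01.
rewrite (exchE y01 gk) (exchE x01 ghk) /jump (cell_exch x01 hk).
rewrite {1}(exchE x01 hk) /jump gcoordD -addrA -mulrDl; congr (_ + _ / _).
rewrite [RHS]addrC subrKA; congr (_ %:R - _).
by congr rank; rewrite [LHS]addrA [LHS]addrAC.
Qed.

(** A fixed point has a fixed index at level [size g], and translation by a nonzero vector fixes no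
    index. *)
Lemma exch_free g x : 0 <= x < 1 -> exch g x = x -> g = 0.
Proof.
move=> x01 gx; apply: (@gcoord_eq0 (size g)); first exact: leq_ldim.
have := cell_exch x01 (leq_ldim F (size g)); rewrite gx.
by rewrite -[LHS]addr0 => /addrI.
Qed.

End Cells.

(** * The Lebesgue space *)

Section Translation.
Variable R : realType.
Implicit Types (c : R) (X A : set R).
Local Notation lambda := ((wlength (R:=R) idfun)^*)%mu.

Definition translate c A : set R := [set x | A (x + c)].

Lemma translateK c A : translate (- c) (translate c A) = A.
Proof. by apply/seteqP; split => x; rewrite /translate/= subrK. Qed.

Lemma translate_itv c (a b : R) :
  translate c `]a, b]%classic = `]a - c, b - c]%classic.
Proof.
by apply/seteqP; split => x; rewrite /translate/= !in_itv/= ltrBlDr lerBrDr.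
Qed.

(** Translating a cover by half-open intervals preserves its total length, which gives one
    inequality; translating back by [- c] gives the other. *)
Lemma outer_translate c X : lambda (translate c X) = lambda X.
Proof.
suff H c' Y : (lambda (translate c' Y) <= lambda Y)%E.
  by apply/eqP; rewrite eq_le H -{1}(translateK c X) H.
apply: le_ereal_inf_tmp => _ [A [mA YA] <-].
have tA k : measurable (translate c' (A k) : set (ocitv_type R)) /\
    wlength idfun (translate c' (A k)) = wlength idfun (A k).
  have [[a b] _ <-] := mA k; rewrite /= translate_itv; split.
    exact: is_ocitv.
  rewrite !wlength_itv/= !lte_fin ltrBlDr subrK.
  by case: ifP => // _; rewrite -!EFinB; congr EFin; ring.
apply: ereal_inf_lbound; exists (fun k => translate c' (A k)) => /=.
  split => [k|x /YA[k _ Akx]]; first by have [] := tA k.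
  by exists k.
by apply: eq_eseriesr => k _; have [] := tA k.
Qed.

(** The Caratheodory condition for the translate at a test set [X] is the one for [A] at [X]
    translated back. *)
Lemma lebesgue_measurable_translate c A :
  lebesgue_measurable A -> lebesgue_measurable (translate c A).
Proof.
have caraE B : lebesgue_measurable B = caratheodory_measurable lambda B by [].
rewrite !caraE => mA X; have := mA (translate (- c) X).
have tK Y : translate c (translate (- c) Y) = Y.
  by apply/seteqP; split => x; rewrite /translate/= addrK.
rewrite -(outer_translate c (translate (- c) X)).
rewrite -(outer_translate c (_ `&` A)) -(outer_translate c (_ `&` ~` A)).
have tI Y Z : translate c (Y `&` Z) = translate c Y `&` translate c Z by [].
by rewrite !tI tK.
Qed.

End Translation.

Section UnitSpace.
Variable R : realType.

(* [unit_space] is the real line with [0, 1[ as the only part carrying mass;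
   membership outside [0, 1[ is irrelevant for measurability, as completeness
   requires. *)
Definition unit_space : Type := R.
Local Notation I := (`[0%R, 1%R[%classic : set R).

Lemma lebesgue_measurable_itv (i : interval R) : lebesgue_measurable [set` i].
Proof.
have := @measurable_itv R i; rewrite /lebesgue_measurable => mi.
exact: (@sub_caratheodory _ _ _ (wlength (R:=R) idfun : {measure set (ocitv_type R) -> \bar R})).
Qed.

Definition unit_measurable (A : set unit_space) : Prop :=
  lebesgue_measurable (A `&` I).

Lemma unit_measurable0 : unit_measurable set0.
Proof. by rewrite /unit_measurable set0I; apply: measurable0. Qed.

Lemma unit_measurableC A : unit_measurable A -> unit_measurable (~` A).
Proof.
move=> mA; rewrite /unit_measurable (_ : _ `&` _ = I `\` (A `&` I)).
  by apply: measurableD => //; apply: lebesgue_measurable_itv.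
by rewrite setDE setCI setIUr setICr setU0 setIC.
Qed.

Lemma unit_measurable_bigcup (A : (set unit_space)^nat) :
  (forall k, unit_measurable (A k)) -> unit_measurable (\bigcup_k A k).
Proof.
move=> mA; rewrite /unit_measurable setI_bigcupl /lebesgue_measurable.
by apply: bigcupT_measurable => k; apply: mA.
Qed.

HB.instance Definition _ := Pointed.copy unit_space R.
HB.instance Definition _ := @isMeasurable.Build default_measure_display
  unit_space unit_measurable unit_measurable0 unit_measurableC
  unit_measurable_bigcup.

Definition unit_measure (A : set unit_space) : \bar R :=
  completed_lebesgue_measure (A `&` I : set R).

Lemma unit_measure0 : unit_measure set0 = 0%E.
Proof. by rewrite /unit_measure set0I measure0. Qed.

Lemma unit_measure_ge0 A : (0 <= unit_measure A)%E.
Proof. exact: measure_ge0. Qed.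

Lemma unit_measure_sigma_additive : semi_sigma_additive unit_measure.
Proof.
move=> A mA tA mUA; rewrite /unit_measure setI_bigcupl.
apply: (@measure_semi_sigma_additive _ _ _ completed_lebesgue_measure
  (fun k => A k `&` I)) => //.
- by move: tA; apply: trivIset_setIr.
- by rewrite -setI_bigcupl.
Qed.

HB.instance Definition _ := isMeasure.Build _ _ _ unit_measure
  unit_measure0 unit_measure_ge0 unit_measure_sigma_additive.

Lemma completed_lebesgue_itv (a b : R) : a <= b ->
  completed_lebesgue_measure (`[a, b[%classic : set R) = (b - a)%:E.
Proof.
move=> ab; have := lebesgue_measure_itv `[a, b[; rewrite /= lte_fin.
rewrite -[LHS]/(completed_lebesgue_measure (`[a, b[%classic : set R)) => ->.
case: ltP => // ba; by rewrite (@le_anti _ _ a b) ?ab// subrr.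
Qed.

Lemma unit_measureT : unit_measure setT = 1%E.
Proof. by rewrite /unit_measure setTI completed_lebesgue_itv// subr0. Qed.

HB.instance Definition _ :=
  Measure_isProbability.Build _ _ _ unit_measure unit_measureT.

Definition unit_prob : probability unit_space R := unit_measure.

(** The isomorphism is the identity of [0, 1[, which misses only the null set {1} of [0, 1]. *)
Lemma unit_space_lebesgue : nonatomic_lebesgue_space unit_prob.
Proof.
split.
  move=> N [A [mA A0 NA]]; apply: completed_lebesgue_measure_is_complete.
  by exists (A `&` I); split => //; apply: setSI.
exists I, I, idfun; split => //.
- split; first by rewrite /measurable/= /unit_measurable setIid; exact: lebesgue_measurable_itv.
  by rewrite /unit_prob/= /unit_measure setICl measure0.
- split.
  + by move=> x /=; rewrite !in_itv/= => /andP[-> /ltW].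
  + exact: lebesgue_measurable_itv.
  + rewrite (_ : _ `\` _ = [set 1]); first exact: lebesgue_measure_set1.
    apply/seteqP; split => x /=; rewrite !in_itv/=.
      move=> [/andP[x0 x1]]; rewrite x0/= => /negP; rewrite -leNgt => x1'.
      by apply/le_anti; rewrite x1.
    by move=> ->; rewrite ler01 lexx ltxx.
- by move=> A AI; rewrite image_id /measurable/= /unit_measurable (setIidl AI).
- by move=> A AI _; rewrite image_id /unit_prob/= /unit_measure (setIidl AI).
Qed.

End UnitSpace.

(** * Cylinder sets, and the exchanges as a free measure-preserving action *)

Section Cylinders.
Variables (F : finFieldType) (R : realType).
Local Notation q := #|F|.
Local Notation Gam k := 'rV[F]_(ldim F k).
Local Notation M k := (#|{: Gam k}|%:R : R).
Local Notation X := (unit_space R).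
Local Notation mu := (unit_prob R).

Definition cylinder k (S : pred (Gam k)) : set X :=
  [set x : R | 0 <= x < 1 /\ S (cell F k x)].

Lemma cylinder1E k (v : Gam k) : cylinder (pred1 v) =
  `[(rank v)%:R / M k, (rank v).+1%:R / M k[%classic :> set R.
Proof.
apply/seteqP; split => x; rewrite /cylinder/= in_itv/= ler_pdivrMr ?natr_card_Gam_gt0//;
  rewrite ltr_pdivlMr ?natr_card_Gam_gt0// [x * _]mulrC.
  by move=> [x01 /eqP/cellP]; apply.
move=> /[dup] vx /andP[l u].
have x01 : 0 <= x < 1.
  rewrite -(pmulr_rge0 _ (natr_card_Gam_gt0 F R k)) (le_trans _ l)//=.
  rewrite -(ltr_pM2l (natr_card_Gam_gt0 F R k)) mulr1 (lt_le_trans u)// ler_nat.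
  exact: rank_lt.
by split => //; apply/eqP/cellP.
Qed.

Lemma measurable_cylinder1 k (v : Gam k) : measurable (cylinder (pred1 v)).
Proof.
rewrite /measurable/= /unit_measurable cylinder1E.
by apply: measurableI; apply: lebesgue_measurable_itv.
Qed.

Lemma cylinder_sub k (S : pred (Gam k)) : cylinder S `<=` `[0, 1[%classic.
Proof. by move=> x []; rewrite /= in_itv. Qed.

Lemma mu_cylinder1 k (v : Gam k) : mu (cylinder (pred1 v)) = ((M k)^-1)%:E.
Proof.
rewrite /unit_prob/= /unit_measure (setIidl (@cylinder_sub k _)) cylinder1E.
rewrite completed_lebesgue_itv; last first.
  by rewrite ler_pM2r ?invr_gt0 ?natr_card_Gam_gt0// ler_nat.
by rewrite -mulrBl -natr1 addrAC subrr add0r mul1r.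
Qed.

Lemma measurableI01 (A : set X) :
  measurable (A `&` `[0, 1[%classic) <-> measurable A.
Proof. by rewrite /measurable/= /unit_measurable -setIA setIid. Qed.

Lemma muI01 (A : set X) : mu (A `&` `[0, 1[%classic) = mu A.
Proof. by rewrite /unit_prob/= /unit_measure -setIA setIid. Qed.

Lemma cylinder_bigcup k (S : pred (Gam k)) :
  cylinder S = \bigcup_(v in [set v | S v]) cylinder (pred1 v).
Proof.
apply/seteqP; split => [x [x01 Sx]|x [v Sv [x01 /= /eqP xv]]].
  by exists (cell F k x) => //; split => /=.
by split=> //; rewrite xv.
Qed.

Lemma cylinderT k : cylinder (xpredT : pred (Gam k)) = `[0, 1[%classic :> set R.
Proof.
by apply/seteqP; split => x; rewrite /cylinder/= in_itv/=; [case|].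
Qed.

Lemma measurable_cylinder k (S : pred (Gam k)) : measurable (cylinder S).
Proof.
rewrite cylinder_bigcup; apply: fin_bigcup_measurable.
  exact: finite_finset.
by move=> v _; apply: measurable_cylinder1.
Qed.

Lemma measurable_split k (A : set X) :
  (forall v : Gam k, measurable (A `&` cylinder (pred1 v))) -> measurable A.
Proof.
move=> mA; apply/measurableI01; rewrite -(cylinderT k) cylinder_bigcup setI_bigcupr.
by apply: fin_bigcup_measurable => //; exact: finite_finset.
Qed.

Lemma mu_split k (A : set X) : measurable A ->
  mu A = (\sum_(v : Gam k) mu (A `&` cylinder (pred1 v)))%E.
Proof.
move=> mA; rewrite -muI01 -(cylinderT k) cylinder_bigcup setI_bigcupr.
rewrite measure_fin_bigcup.
- rewrite (fsbigE (index_enum (Gam k))) ?index_enum_uniq//.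
    by apply: eq_bigl => v; rewrite mem_set.
  by move=> v _; rewrite mem_index_enum.
- exact: finite_finset.
- by move=> v w _ _ [x [[_ [_ /= /eqP <-]] [_ [_ /= /eqP <-]]]].
- by move=> v _; apply: measurableI => //; apply: measurable_cylinder1.
Qed.

Lemma mu_cylinder k (S : pred (Gam k)) :
  mu (cylinder S) = (#|S|%:R / M k)%:E.
Proof.
rewrite (mu_split k); last exact: measurable_cylinder.
transitivity (\sum_(v : Gam k | S v) ((M k)^-1)%:E)%E; last first.
  by rewrite sumEFin sumr_const mulr_natl; congr (_ *+ _)%:E; apply: eq_card.
rewrite [RHS]big_mkcond; apply: eq_bigr => v _; case: ifPn => Sv.
  rewrite -(mu_cylinder1 v); congr (mu _); apply/setIidr => x [x01 /= /eqP xv].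
  by split=> //; rewrite xv.
rewrite (_ : _ `&` _ = set0) ?measure0//; apply/seteqP; split => // x.
by move=> [[_ Sx] [_ /= /eqP xv]]; rewrite xv (negPf Sv) in Sx.
Qed.

Lemma pull_cylinder m (S : pred (Gam m)) j : cylinder (pull S j) = cylinder S.
Proof.
apply/seteqP; split => x [x01]; first by rewrite (pull_cell S j x01).
by move=> Sx; split=> //; rewrite (pull_cell S j x01).
Qed.

Section Action.
Variable L : {poly F} -> {poly F}.
Hypothesis LD : {morph L : p r / p + r}.
Hypothesis size_L : forall p, size (L p) = size p.
Implicit Types g h : {poly F}.
Local Notation T := (@exch F R L : {poly F} -> X -> X).

Let step k g (v : Gam k) : R :=
  ((rank (v + gcoord L k g))%:R - (rank v)%:R) / M k.

(** On each interval of a fine enough level the exchange is a translation; measurability and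
    invariance of the measure are thereby reduced to those of Lebesgue measure under
    translations. *)
Lemma exch_preimage_cylinder1 k g (v : Gam k) (A : set X) :
  (size g <= ldim F k)%N ->
  T g @^-1` A `&` cylinder (pred1 v) =
  translate (step g v) (A `&` cylinder (pred1 (v + gcoord L k g))) :> set R.
Proof.
move=> gk; apply/seteqP; split => x.
  move=> [Agx [x01 /= /eqP xv]].
  have gx : T g x = x + step g v by rewrite /step -xv (exchE size_L x01 gk).
  rewrite /translate/= -gx; split=> //; split => /=.
    by rewrite (exch01 size_L).
  by rewrite (cell_exch size_L x01 gk) xv.
rewrite /translate/= => -[Ax cx].
have {cx} xv : cylinder (pred1 v) x.
  move: cx; rewrite !cylinder1E /= !in_itv/= /step.
  rewrite -lerBlDr -ltrBrDr -!mulrBl opprB -natr1 -[in X in _ -> X]natr1.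
  by rewrite addrCA subrr addr0 (addrAC _ 1) addrCA subrr addr0 addrC.
split=> //=; move: xv => [x01 /= /eqP xv].
by rewrite (exchE size_L x01 gk) /jump xv.
Qed.

Lemma measurable_preimage_exch g (A : set X) :
  measurable A -> measurable (T g @^-1` A).
Proof.
move=> mA; have gk := leq_ldim F (size g).
apply: (@measurable_split (size g)) => v.
rewrite /measurable/= /unit_measurable (exch_preimage_cylinder1 v A gk).
apply: measurableI; last exact: lebesgue_measurable_itv.
apply: lebesgue_measurable_translate.
have : measurable (A `&` cylinder (pred1 (v + gcoord L (size g) g))).
  by apply: measurableI => //; exact: measurable_cylinder1.
rewrite {1}/measurable/= /unit_measurable (setIidl _)//.
by move=> x [_ /cylinder_sub].
Qed.

Lemma measurable_exch g : measurable_fun [set: X] (T g).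
Proof. by move=> _ A mA; rewrite setTI; exact: measurable_preimage_exch. Qed.

Lemma mu_preimage_exch g (A : set X) :
  measurable A -> mu (T g @^-1` A) = mu A.
Proof.
move=> mA; have gk := leq_ldim F (size g).
rewrite (mu_split (size g) mA) (mu_split (size g)); last exact: measurable_preimage_exch.
rewrite [RHS](reindex_inj (addIr (gcoord L (size g) g))); apply: eq_bigr => v _.
have sub v' (B : set X) : B `&` cylinder (pred1 v') `<=` `[0, 1[%classic.
  by move=> x [_ /cylinder_sub].
rewrite /unit_prob/= /unit_measure !(setIidl (sub _ _ _)).
rewrite (exch_preimage_cylinder1 v A gk); exact: outer_translate.
Qed.

Lemma exch_preserving : measure_preserving_action mu T.
Proof.
split.
- exact: exch0.
- exact: exchD.
- exact: measurable_exch.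
- exact: mu_preimage_exch.
Qed.

Lemma exch_free_action : free_action mu T.
Proof.
move=> g g0; have fixE : [set x | T g x = x] `&` `[0, 1[%classic = set0.
  apply/seteqP; split => // x [/= gx]; rewrite in_itv/= => x01.
  by case/eqP: g0; exact: (exch_free size_L x01 gx).
split; first by apply/measurableI01; rewrite fixE; exact: measurable0.
by rewrite -muI01 fixE measure0.
Qed.

(** Weak mixing is stated with images, whereas the computations use preimages. *)
Lemma exch_image g (A : set X) : T g @` A = T (- g) @^-1` A.
Proof.
apply/seteqP; split => [_ [x Ax <-]|x Ax] /=.
  by rewrite -exchD// addNr exch0.
by exists (T (- g) x) => //; rewrite -exchD// subrr exch0.
Qed.

Lemma exch_preimage_cylinder k g (S : pred (Gam k)) : (size g <= ldim F k)%N ->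
  T g @^-1` cylinder S = cylinder (fun v => S (v + gcoord L k g)).
Proof.
move=> gk; apply/seteqP; split => x [x01 Sx].
  have {}x01 : 0 <= x < 1 by rewrite -(exch01 size_L g).
  by move: Sx; rewrite (cell_exch size_L x01 gk).
by split; rewrite /= ?(exch01 size_L)// (cell_exch size_L x01 gk).
Qed.

End Action.

End Cylinders.

(** * Approximation by cylinders *)

Section SetDistance.
Context {d : measure_display} {T : measurableType d} {R : realType}.
Variable P : probability T R.
Implicit Types A B C : set T.
Local Notation pr A := (fine (P A)).

Lemma EFin_pr A : measurable A -> (pr A)%:E = P A.
Proof. by move=> mA; rewrite fineK// fin_num_measure. Qed.

Lemma pr_ge0 A : 0 <= pr A.
Proof. exact: fine_ge0. Qed.

Lemma pr_le A B : measurable A -> measurable B -> A `<=` B -> pr A <= pr B.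
Proof. by move=> mA mB AB; rewrite -lee_fin !EFin_pr// le_measure ?inE. Qed.

Lemma pr_le1 A : measurable A -> pr A <= 1.
Proof. by move=> mA; rewrite -lee_fin EFin_pr// probability_le1. Qed.

Lemma pr_le_add A B C : measurable A -> measurable B -> measurable C ->
  A `<=` B `|` C -> pr A <= pr B + pr C.
Proof.
move=> mA mB mC AB; rewrite -lee_fin EFinD !EFin_pr//.
apply: le_trans (measureU2 _ _ _) => //.
by rewrite le_measure ?inE//; apply: measurableU.
Qed.

Lemma measurableY A B : measurable A -> measurable B -> measurable (A `+` B).
Proof. by move=> mA mB; apply: measurableU; apply: measurableD. Qed.

(** The pseudometric of the measure algebra: the measure of the symmetric difference. *)
Definition dist A B := pr (A `+` B).

Lemma dist_ge0 A B : 0 <= dist A B. Proof. exact: pr_ge0. Qed.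

Lemma distC A B : dist A B = dist B A.
Proof. by rewrite /dist setYC. Qed.

Lemma dist_triangle B A C : measurable A -> measurable B -> measurable C ->
  dist A C <= dist A B + dist B C.
Proof.
move=> mA mB mC; apply: pr_le_add; try exact: measurableY.
move=> x; rewrite /setY/=; have [Bx|Bx] := pselect (B x); tauto.
Qed.

Lemma pr_dist A B : measurable A -> measurable B ->
  `|pr A - pr B| <= dist A B.
Proof.
move=> mA mB; have mY := measurableY mA mB.
have AB : pr A <= pr B + dist A B.
  by apply: pr_le_add => // x Ax; have [?|?] := pselect (B x); [left|right; left].
have BA : pr B <= pr A + dist A B.
  by apply: pr_le_add => // x Bx; have [?|?] := pselect (A x); [left|right; right].
by rewrite ler_norml; apply/andP; split; lra.
Qed.

Lemma distI A B C : measurable A -> measurable B -> measurable C ->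
  dist (A `&` C) (B `&` C) <= dist A B.
Proof.
move=> mA mB mC; apply: pr_le.
- by apply: measurableY; apply: measurableI.
- exact: measurableY.
- by move=> x; rewrite /setY/=; tauto.
Qed.

Lemma distU A A' B B' : measurable A -> measurable A' -> measurable B ->
  measurable B' -> dist (A `|` B) (A' `|` B') <= dist A A' + dist B B'.
Proof.
move=> mA mA' mB mB'; apply: pr_le_add; do ?[exact: measurableY].
- by apply: measurableY; apply: measurableU.
- move=> x; rewrite /setY/=; have [?|?] := pselect (A x);
  have [?|?] := pselect (A' x); have [?|?] := pselect (B x); tauto.
Qed.

End SetDistance.

Section Approximation.
Variables (F : finFieldType) (R : realType).
Local Notation Gam k := 'rV[F]_(ldim F k).
Local Notation M k := (#|{: Gam k}|%:R : R).
Local Notation X := (unit_space R).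
Local Notation mu := (unit_prob R).

Definition is_cylinder k (A : set X) := exists S : pred (Gam k), A = cylinder S.

Lemma is_cylinder_le j k A : (j <= k)%N -> is_cylinder j A -> is_cylinder k A.
Proof.
move=> jk [S ->]; rewrite -(subnK jk); exists (pull S (k - j)).
by rewrite pull_cylinder.
Qed.

Lemma measurable_is_cylinder k A : is_cylinder k A -> measurable A.
Proof. by move=> [S ->]; apply: measurable_cylinder. Qed.

Definition approximable (A : set X) := forall e : R, 0 < e ->
  exists k C, is_cylinder k C /\ dist mu A C < e.

Lemma ltr_card_Gam k : k%:R < M k.
Proof.
rewrite ltr_nat card_Gam; apply: leq_trans (ltn_expl k (card_finNzRing_gt1 F)) _.
by rewrite leq_pexp2l ?leq_ldim// ltnW// card_finNzRing_gt1.
Qed.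

Lemma approximable0 : approximable set0.
Proof.
move=> e e0; exists 0%N, (cylinder (pred0 : pred (Gam 0))); split.
  by exists pred0.
rewrite (_ : cylinder _ = set0) ?/dist ?setYK ?measure0//.
by apply/seteqP; split => // x [].
Qed.

Lemma approximableU A B : measurable A -> measurable B ->
  approximable A -> approximable B -> approximable (A `|` B).
Proof.
move=> mA mB aA aB e e0; have e20 : 0 < e / 2 by rewrite divr_gt0.
have [j [C [cC dC]]] := aA _ e20; have [k [D [cD dD]]] := aB _ e20.
have mC := measurable_is_cylinder cC; have mD := measurable_is_cylinder cD.
exists (maxn j k), (C `|` D); split; last first.
  by apply: le_lt_trans (distU _ mA mC mB mD) _; lra.
have [S ->] := is_cylinder_le (leq_maxl j k) cC.
have [S' ->] := is_cylinder_le (leq_maxr j k) cD.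
exists [pred v | S v || S' v]; apply/seteqP; split => x.
  by move=> [[x01 Sx]|[x01 Sx]]; split => //=; rewrite Sx ?orbT.
by move=> [x01 /= /orP[]]; [left|right].
Qed.

Lemma approximable_lim (A : set X) : measurable A ->
  (forall e : R, 0 < e ->
     exists B, [/\ measurable B, approximable B & dist mu A B < e]) ->
  approximable A.
Proof.
move=> mA AB e e0; have e20 : 0 < e / 2 by rewrite divr_gt0.
have [B [mB aB dB]] := AB _ e20; have [k [C [cC dC]]] := aB _ e20.
exists k, C; split => //; have mC := measurable_is_cylinder cC.
by apply: le_lt_trans (dist_triangle _ mA mB mC) _; lra.
Qed.

Lemma unit_measurable_itv (i : interval R) :
  measurable ([set` i] : set X).
Proof. by apply: measurableI; exact: lebesgue_measurable_itv. Qed.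

(** Take the cells whose left endpoint lies in ]a, b]. An error can occur only in the cell of [a] or
    that of [b], hence on measure at most [2 / M k]. *)
Lemma approximable_itv (a b : R) : approximable `]a, b]%classic.
Proof.
move=> e e0; have [k ke] : exists k, 2 / M k < e.
  exists (Num.bound (2 / e)); rewrite ltr_pdivrMr ?natr_card_Gam_gt0// mulrC -ltr_pdivrMr//.
  by apply: lt_trans (archi_boundP _) (ltr_card_Gam _); rewrite divr_ge0// ltW.
pose S : pred (Gam k) := fun v => a < (rank v)%:R / M k <= b.
exists k, (cylinder S); split; first by exists S.
apply: le_lt_trans ke.
(* For [c] outside [0, 1[ this is some cell of no significance; it still has measure [1 / M k], and
   [cellE] concerns only points [c] inside. *)
pose C (c : R) : set X := cylinder (pred1 (cell F k c)).
have mC c : measurable (C c) by exact: measurable_cylinder1.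
have prC c : fine (mu (C c)) = (M k)^-1 by rewrite mu_cylinder1.
have mab : measurable (`]a, b]%classic : set X) by exact: unit_measurable_itv.
have mS : measurable (cylinder S : set X) by exact: measurable_cylinder.
rewrite /dist -(muI01 (_ `+` _)) (_ : 2 / M k = fine (mu (C a)) + fine (mu (C b))); last first.
  by rewrite !prC; lra.
apply: pr_le_add => //.
  by apply/measurableI01; apply: measurableY.
move=> x [] /[swap]; rewrite /= in_itv/= => x01 xS.
set y := (rank (cell F k x))%:R / M k.
have yx : 0 <= y <= x.
  have /andP[l _] := cell_itv F k x01.
  by rewrite /y divr_ge0//= ler_pdivrMr ?natr_card_Gam_gt0// mulrC.
have cellE c : y <= c -> c <= x -> C c x.
  move=> yc cx; have c01 : 0 <= c < 1 by lra.
  split=> //=; apply/eqP/esym/cellP => //.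
  have /andP[_ u] := cell_itv F k x01.
  rewrite (le_lt_trans _ u) ?ler_wpM2l// andbT.
  by rewrite mulrC -ler_pdivrMr ?natr_card_Gam_gt0.
have SE : cylinder S x <-> a < y <= b by split => [[]|].
have [ya|ya] := leP y a; have [xa|xa] := leP x a.
- case: xS => -[]; first by move=> /=; rewrite in_itv/= => /andP[]; lra.
  by move=> /SE/andP[]; lra.
- by left; apply: cellE => //; exact: ltW.
- lra.
have [yb|yb] := leP y b; have [xb|xb] := leP x b.
- by case: xS => -[] /=; rewrite in_itv/= xa xb SE ya yb.
- by right; apply: cellE => //; exact: ltW.
- lra.
by case: xS => -[] /=; rewrite ?in_itv/= SE => /andP[] *; lra.
Qed.

Lemma dist_sup (A B : set X) : measurable A -> measurable B ->
  A `&` `[0, 1[%classic `<=` B -> dist mu A B = fine (mu B) - fine (mu A).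
Proof.
move=> mA mB AB; have mAB : measurable (A `&` B) by apply: measurableI.
have mBA : measurable (B `\` A) by apply: measurableD.
have -> : fine (mu A) = fine (mu (A `&` B)).
  rewrite -(muI01 A) -(muI01 (A `&` B)); congr (fine (mu _)).
  by apply/seteqP; split => x [Ax Ix]; split => //; [split; last exact: AB|case: Ax].
have := measureDI mu mB mA; rewrite setIC => /(congr1 fine).
rewrite fineD ?fin_num_measure// => ->; rewrite addrK /dist.
congr fine; rewrite -[LHS]muI01 -[RHS]muI01; congr (mu _).
apply/seteqP; split => x []; rewrite /setY/=; last by move=> ? ?; split => //; right.
by move=> [[Ax nBx] Ix|]; [case: nBx; apply: AB|].
Qed.

(** By continuity from below, the countable union is a limit of finite unions. *)
Lemma approximable_bigcup (C : (set X)^nat) : (forall n, measurable (C n)) ->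
  (forall n, approximable (C n)) -> approximable (\bigcup_n C n).
Proof.
move=> mC aC; pose D n := \big[setU/set0]_(i < n) C i.
have mD n : measurable (D n) by apply: bigsetU_measurable.
have mU : measurable (\bigcup_n C n) by apply: bigcupT_measurable.
have aD n : approximable (D n).
  elim: n => [|n IH]; first by rewrite /D big_ord0; exact: approximable0.
  rewrite /D big_ord_recr/=; exact: (approximableU (mD n) (mC n) IH (aC n)).
apply: approximable_lim => // e e0.
have : (mu \o D) n @[n --> \oo] --> mu (\bigcup_n D n).
  apply: nondecreasing_cvg_mu => //; first exact: bigcupT_measurable.
  by apply/nondecreasing_seqP => n; apply/subsetPset; rewrite /D big_ord_recr; exact: subsetUl.
have UD : \bigcup_n D n = \bigcup_n C n.
  rewrite -[RHS]bigcup_bigsetU_bigcup; apply/seteqP; split => x [n _ Dx].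
    by exists n => //; rewrite big_ord_recr; left.
  by move=> /=; exists n.+1.
rewrite UD => cv.
have /fine_cvg/cvgrPdist_lt/(_ e e0)[n _ /(_ n (leqnn n))] :
    (mu \o D) n @[n --> \oo] --> (fine (mu (\bigcup_n C n)))%:E.
  by rewrite fineK// fin_num_measure.
move=> dn; exists (D n); split => //; apply: le_lt_trans dn.
rewrite distC dist_sup//; first exact: ler_norm.
by rewrite -UD => x [Dx _]; exists n.
Qed.

(** Lebesgue measure is an infimum over countable covers by half-open intervals, so [A] is close to
    the union of such a cover, which is approximable. *)
Lemma measurable_approximable A : measurable A -> approximable A.
Proof.
move=> mA; apply: approximable_lim => // e e0.
pose A' : set R := A `&` `[0, 1[%classic.
have finA : mu A \is a fin_num by rewrite fin_num_measure.
have /ereal_inf_lt[_ [C [mC AC] <-] sC] :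
  (completed_lebesgue_measure A' < mu A + e%:E)%E.
  by rewrite -[ltLHS]/(mu A) lteDl ?lte_fin.
have aC n : approximable (C n) by have [[a b] _ <-] := mC n; exact: approximable_itv.
have mCX n : measurable (C n : set X).
  by have [[a b] _ <-] := mC n; exact: unit_measurable_itv.
have mU : measurable (\bigcup_n C n : set X) by apply: bigcupT_measurable.
exists (\bigcup_n C n); split => //; first exact: approximable_bigcup.
rewrite dist_sup// ltrBlDl -lte_fin EFinD !EFin_pr//.
(* The chosen intervals also cover their own union, so their total length bounds its measure. *)
apply: le_lt_trans sC; apply: ereal_inf_lbound; exists C => //; split => //.
Qed.

End Approximation.

(** * Weak mixing *)

Section Folner.
Variables (R : realType) (G : zmodType) (I : finType) (s : I -> G) (c : G -> R).
Hypotheses (c0 : forall g, 0 <= c g) (c1 : forall g, c g <= 1).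
Implicit Types Phi : {fset G}.

(** The terms common to [Phi] and its translate agree, and each remaining term is at most 1. *)
Lemma folner_translate Phi x : \sum_(g <- Phi) c g <=
  \sum_(g <- Phi) c (x + g) + #|` symdiff [fset (g + x)%R | g in Phi]%fset Phi|%:R.
Proof.
pose Psi := [fset (g + x)%R | g in Phi]%fset.
have -> : \sum_(g <- Phi) c (x + g) = \sum_(g <- Psi) c g.
  rewrite big_imfset/=; last by move=> a b _ _ /addIr.
  by apply: eq_bigr => g _; rewrite addrC.
rewrite (bigID (mem Psi))/= lerD//.
  rewrite -big_filter (perm_big [seq g <- Psi | g \in Phi]).
    by rewrite big_filter big_mkcond/=; apply: ler_sum => g _; case: ifP.
  apply: uniq_perm; rewrite ?filter_uniq ?fset_uniq// => g.
  by rewrite !mem_filter andbC.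
apply: (@le_trans _ _ (\sum_(g <- Phi | g \notin Psi) 1)).
  by apply: ler_sum => g _.
rewrite -big_filter big_const_seq iter_addr_0 count_predT ler_nat.
apply: uniq_leq_size; first by rewrite filter_uniq ?fset_uniq.
move=> g; rewrite mem_filter => /andP[gPsi gPhi].
by rewrite /symdiff !inE gPsi gPhi orbT.
Qed.

(* By almost invariance, averaging [c] over [Phi N] is the same in the limit as
   averaging over [Phi N] the means of [c] over the translates of [s]. *)
Lemma folner_average (e : R) (Phi : nat -> {fset G}) :
  (0 < #|I|)%N -> folner (R := R) Phi -> 0 < e ->
  (forall g, (\sum_x c (s x + g)) / #|I|%:R <= e) ->
  \forall N \near \oo, #|` Phi N|%:R^-1 * (\sum_(g <- Phi N) c g) < 2 * e.
Proof.
move=> I0 [Phi0 PhiF] e0 ce.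
pose D x N : R := #|` symdiff [fset (g + s x)%R | g in Phi N]%fset (Phi N)|%:R /
   #|` Phi N|%:R.
have cD : (\sum_x D x N) @[N --> \oo] --> (0 : R).
  rewrite [X in _ --> X](_ : 0 = \sum_(x : I) (0 : R)); last by rewrite big1.
  apply: cvg_big => [|x _]; [exact: add_continuous|exact: PhiF].
have I0' : 0 < #|I|%:R :> R by rewrite ltr0n.
(* Summed over the [#|I|] translates, the means give [e * #|I|]; allowing the same amount for the
   boundary terms leads to [2 * e] after division by [#|I|]. *)
have eI : 0 < e * #|I|%:R by rewrite mulr_gt0.
have /cvgrPdist_lt/(_ _ eI) := cD; apply: filterS => N.
rewrite sub0r normrN => DN; have {DN} DN := le_lt_trans (ler_norm _) DN.
have P0 : 0 < #|` Phi N|%:R :> R by rewrite ltr0n cardfs_gt0.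
rewrite mulrC ltr_pdivrMr// -(ltr_pM2l I0').
have sumle : #|I|%:R * (\sum_(g <- Phi N) c g) <=
    \sum_(g <- Phi N) \sum_x c (s x + g) + (\sum_x D x N) * #|` Phi N|%:R.
  rewrite mulr_natl -sumr_const [X in _ <= X + _]exchange_big/= mulr_suml -big_split/=.
  rewrite (eq_bigl xpredT)//; apply: ler_sum => x _.
  by rewrite /D divfK ?gt_eqF//; exact: folner_translate.
apply: le_lt_trans sumle _.
have : \sum_(g <- Phi N) \sum_x c (s x + g) <= e * #|I|%:R * #|` Phi N|%:R.
  apply: (@le_trans _ _ (\sum_(g <- Phi N) (e * #|I|%:R))).
    by apply: ler_sum => g _; rewrite -ler_pdivrMr.
  by rewrite big_const_seq iter_addr_0 count_predT [leRHS]mulr_natr.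
move: DN; rewrite -(ltr_pM2r P0).
move: (\sum_(g <- _) _) (\sum_x _) (#|I|%:R) (#|` _|%:R) => a b i p; lra.
Qed.

End Folner.

Section WeakMixing.
Variables (F : finFieldType) (R : realType).
Local Notation q := #|F|.
Local Notation Gam k := 'rV[F]_(ldim F k).
Local Notation M k := (#|{: Gam k}|%:R : R).
Local Notation X := (unit_space R).
Local Notation mu := (unit_prob R).
Local Notation pr A := (fine (mu A)).
Variable L : {poly F} -> {poly F}.
Hypothesis LD : {morph L : p r / p + r}.
Hypothesis size_L : forall p, size (L p) = size p.
Hypothesis L_surj : forall p, exists r, L r = p.
Local Notation T := (@exch F R L : {poly F} -> X -> X).
Implicit Types g h : {poly F}.

Lemma pull_comp (S S' : Type) m (f : S -> S') (u : Gam m -> S) j :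
  pull (f \o u) j = f \o pull u j.
Proof. by elim: j => //= j ->. Qed.

Definition cov (A B : set X) g := pr (A `&` T g @` B) - pr A * pr B.

Lemma pr_cylinder k (S : pred (Gam k)) :
  pr (cylinder S) = (\sum_x (S x)%:R) / M k.
Proof.
rewrite mu_cylinder/= -sum1_card natr_sum big_mkcond; congr (_ / _).
by apply: eq_bigr => x _; rewrite unfold_in; case: (S x).
Qed.

(** Centring the indicator of [S'] absorbs the product of the measures and provides the function of
    mean 0 that the decay of correlations requires. *)
Lemma cov_cylinder k (S S' : pred (Gam k)) g : (size g <= ldim F k)%N ->
  cov (cylinder S) (cylinder S') g =
  corr (fun x => (S' x)%:R - pr (cylinder S')) (fun x => (S x)%:R)
    (gcoord L k g) / M k.
Proof.
move=> gk; rewrite /cov (exch_image LD size_L) (exch_preimage_cylinder _ size_L).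
  have -> : cylinder S `&` cylinder (fun v => S' (v + gcoord L k (- g))) =
      cylinder (fun v => S v && S' (v + gcoord L k (- g))) :> set X.
    apply/seteqP; split => x; first by move=> [[x01 Sx] [_ Sx']]; split; rewrite ?Sx.
    by move=> [x01 /andP[]].
  rewrite [pr (cylinder S)]pr_cylinder [X in X - _]pr_cylinder /corr.
  rewrite mulrAC -mulrBl; congr (_ / _); rewrite mulr_suml -sumrB; apply: eq_bigr => x _.
  by rewrite (gcoordN LD) mulrBl -natrM mulnb andbC [in RHS]mulrC.
by rewrite size_polyN.
Qed.

(** Supplies the uniform bound on means over translates of a finite family that [folner_average]
    asks for; the family lists preimages of all elements of one group G_k under [gcoord]. *)
Lemma cov_small m (S S' : pred (Gam m)) (e : R) : 0 < e ->
  exists k (s : Gam k -> {poly F}), forall g,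
    (\sum_x `|cov (cylinder S) (cylinder S') (s x + g)|) / M k <= e.
Proof.
move=> e0; pose u x : R := (S' x)%:R - pr (cylinder S').
pose w x : R := (S x)%:R.
have u0 : \sum_x u x = 0.
  rewrite sumrB sumr_const -mulr_natr pr_cylinder divfK ?subrr//.
  by rewrite gt_eqF// natr_card_Gam_gt0.
pose Q := (m + q.-1)%:R * (corr_mass u w / M m ^+ 2).
have Q0 : 0 <= Q.
  by rewrite mulr_ge0// divr_ge0 ?corr_mass_ge0// exprn_ge0.
(* The bound decays like [Q / (i + m + q.-1)]; the successor in the witness keeps the denominator
   positive. *)
have [i Qi] : exists i, (m + q.-1)%:R / (i + m + q.-1)%:R * (corr_mass u w / M m ^+ 2) <= e.
  exists (Num.bound (Q / e)).+1; rewrite mulrAC -/Q ler_pdivrMr; last by rewrite ltr0n.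
  rewrite mulrC -ler_pdivrMr//; apply: ltW.
  apply: lt_le_trans (archi_boundP _) _; first by rewrite divr_ge0// ltW.
  by rewrite ler_nat -addnA (leq_trans (leqnSn _)) ?leq_addr.
have sP (x : Gam (i + m)) : exists g : {poly F},
    (size g <= ldim F (i + m))%N /\ gcoord L (i + m) g = x.
  by have [g] := gcoord_surj size_L L_surj x; exists g.
pose s x := projT1 (cid (sP x)).
exists (i + m)%N, s => g; apply: le_trans Qi.
(* Only the level of the computation depends on [g]; the family [s] and the bound were fixed
   before. *)
pose j := size g.
have gk : (size g <= ldim F (j + (i + m)))%N.
  by apply: leq_trans (leq_ldim F _) _; apply: ldim_homo; rewrite /j; lia.
have := @sum_corr_le F R m u w i j (gcoord L (j + (i + m)) g) u0.
congr (_ / _ <= _); rewrite mulr_suml; apply: eq_bigr => x _.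
rewrite /s; case: (cid (sP x)) => h /= [hk hx].
have hk' : (size h <= ldim F (j + (i + m)))%N.
  by apply: leq_trans hk _; apply: ldim_homo; lia.
rewrite -(pull_cylinder R S i) -(pull_cylinder R S' i).
rewrite -(pull_cylinder R (pull S i) j) -(pull_cylinder R (pull S' i) j).
rewrite cov_cylinder; last first.
  by apply: leq_trans (size_polyD _ _) _; rewrite geq_max hk' gk.
rewrite normrM [ `|_^-1| ]ger0_norm ?invr_ge0//; congr (`|_| / _).
rewrite (gcoordD LD) addrC (gcoord_emb size_L _ hk) hx.
have pE (f : bool -> R) (V : pred (Gam m)) :
  pull (pull (f \o V) i) j = f \o pull (pull V i) j by rewrite !pull_comp.
rewrite !pull_cylinder -[u]/((fun b : bool => b%:R - pr (cylinder S')) \o S').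
by rewrite -[w]/((fun b : bool => b%:R) \o S) !pE.
Qed.

Lemma measurable_exch_image g (A : set X) :
  measurable A -> measurable (T g @` A).
Proof.
by rewrite (exch_image LD size_L) => mA; exact: measurable_preimage_exch.
Qed.

Lemma dist_exch g (A B : set X) : measurable A -> measurable B ->
  dist mu (T g @` A) (T g @` B) = dist mu A B.
Proof.
move=> mA mB; rewrite !(exch_image LD size_L) /dist.
rewrite -(mu_preimage_exch size_L (- g) (measurableY mA mB)).
by congr (fine (mu _)).
Qed.

(** The factor 2 arises because the intersection and the product of measures each change by at most
    the sum of the two distances. *)
Lemma cov_dist (A A' B B' : set X) g : measurable A -> measurable A' ->
  measurable B -> measurable B' ->
  `|cov A B g| <= `|cov A' B' g| + 2 * (dist mu A A' + dist mu B B').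
Proof.
move=> mA mA' mB mB'.
have mT := measurable_exch_image g mB; have mT' := measurable_exch_image g mB'.
have mI : measurable (A `&` T g @` B) by apply: measurableI.
have mI' : measurable (A' `&` T g @` B') by apply: measurableI.
have mI2 : measurable (A' `&` T g @` B) by apply: measurableI.
have d1 : dist mu (A `&` T g @` B) (A' `&` T g @` B') <=
    dist mu A A' + dist mu B B'.
  apply: le_trans (dist_triangle _ mI mI2 mI') _; apply: lerD; first exact: distI.
  rewrite -(dist_exch g mB mB') ![A' `&` _]setIC; exact: distI.
have d2 := pr_dist mu mI mI'; have dA := pr_dist mu mA mA'; have dB := pr_dist mu mB mB'.
have : `|pr A * pr B - pr A' * pr B'| <= dist mu A A' + dist mu B B'.
  rewrite (_ : _ - _ = (pr A - pr A') * pr B + pr A' * (pr B - pr B')); last by ring.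
  apply: le_trans (ler_normD _ _) _; rewrite !normrM.
  rewrite (ger0_norm (pr_ge0 _ B)) (ger0_norm (pr_ge0 _ A')) lerD//.
    by apply: le_trans dA; rewrite ler_piMr// pr_le1.
  by apply: le_trans dB; rewrite ler_piMl// pr_le1.
move: (le_trans d2 d1); rewrite /cov.
move: (pr (A `&` _)) (pr (A' `&` _)) (pr A * _) (pr A' * _) => a b x y ab xy.
have -> : a - x = (b - y) + ((a - b) - (x - y)) by ring.
apply: le_trans (ler_normD _ _) _; rewrite lerD2l.
by apply: le_trans (ler_normB _ _) _; lra.
Qed.

Lemma cov_le1 (A B : set X) g : measurable A -> measurable B -> `|cov A B g| <= 1.
Proof.
move=> mA mB; have mT := measurable_exch_image g mB.
have mI : measurable (A `&` T g @` B) by apply: measurableI.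
rewrite /cov ler_norml; have a0 := pr_ge0 mu (A `&` T g @` B).
have a1 := pr_le1 mu mI.
have b0 : 0 <= pr A * pr B by rewrite mulr_ge0 ?pr_ge0.
have b1 : pr A * pr B <= 1 by rewrite mulr_ile1 ?pr_ge0 ?pr_le1.
by apply/andP; split; lra.
Qed.

Lemma exch_weakly_mixing : weakly_mixing mu T.
Proof.
move=> A B mA mB Phi PhiF; apply/cvgrPdist_lt => e e0.
(* Averaging costs 2 such parts and the two approximations cost 4, which leaves 6 / 10 of [e]. *)
have e10 : 0 < e / 10 by rewrite divr_gt0.
have [j [A' [cA dA]]] := measurable_approximable F mA e10.
have [k [B' [cB dB]]] := measurable_approximable F mB e10.
have mA' := measurable_is_cylinder cA; have mB' := measurable_is_cylinder cB.
have [S AS] := is_cylinder_le (leq_maxl j k) cA.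
have [S' BS] := is_cylinder_le (leq_maxr j k) cB.
have [l [s ls]] := cov_small S S' e10; rewrite -AS -BS in ls.
have := folner_average (fun g => normr_ge0 (cov A' B' g))
  (fun g => cov_le1 g mA' mB') (card_Gam_gt0 F l) PhiF e10 ls.
apply: filterS => N avg; rewrite sub0r normrN.
have P0 : 0 < #|` Phi N|%:R :> R by rewrite ltr0n cardfs_gt0; case: PhiF.
rewrite ger0_norm; last first.
  by rewrite mulr_ge0 ?invr_ge0//; apply: sumr_ge0.
apply: (@le_lt_trans _ _ (#|` Phi N|%:R^-1 *
    \sum_(g <- Phi N) (`|cov A' B' g| + 4 * (e / 10)))).
  rewrite ler_wpM2l ?invr_ge0//; apply: ler_sum => g _.
  by apply: le_trans (cov_dist g mA mA' mB mB') _; rewrite lerD2l; lra.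
rewrite big_split/= mulrDr big_const_seq iter_addr_0 count_predT -[X in _ + _ * X < _]mulr_natl.
rewrite mulKf ?gt_eqF//; lra.
Qed.

End WeakMixing.

(** * Rigidity in mean square *)

Section SquareMean.
Context {d : measure_display} {T : measurableType d} {R : realType}.
Variable P : probability T R.
Implicit Types f g : T -> R.
Local Open Scope ereal_scope.

Definition esqr f : T -> \bar R := fun x => ((f x ^+ 2)%R)%:E.

Definition sqmean f := \int[P]_x esqr f x.

Lemma measurable_sqr f : measurable_fun [set: T] f ->
  measurable_fun [set: T] (esqr f).
Proof. by move=> mf; apply/measurable_EFinP; exact: measurable_funX. Qed.

Lemma sqmean_ge0 f : 0 <= sqmean f.
Proof. by apply: integral_ge0 => x _; rewrite lee_fin sqr_ge0. Qed.

(** From (a + b)^2 <= 2 a^2 + 2 b^2; this serves as the triangle inequality without square roots. *)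
Lemma sqmeanD_le f g : measurable_fun [set: T] f -> measurable_fun [set: T] g ->
  sqmean (f \+ g)%R <= 2%:E * sqmean f + 2%:E * sqmean g.
Proof.
move=> mf mg; have mf2 := measurable_sqr mf; have mg2 := measurable_sqr mg.
have mfg2 : measurable_fun [set: T] (esqr (f \+ g)%R).
  exact: measurable_sqr (measurable_funD mf mg).
have pos f' x : 0 <= esqr f' x by rewrite lee_fin sqr_ge0.
rewrite /sqmean -!ge0_integralZl_EFin//.
have mf3 : measurable_fun [set: T] (fun x => 2%:E * esqr f x) by apply: measurable_funeM.
have mg3 : measurable_fun [set: T] (fun x => 2%:E * esqr g x) by apply: measurable_funeM.
have pos2 f' x : 0 <= 2%:E * esqr f' x by rewrite mule_ge0.
rewrite -ge0_integralD//.
apply: ge0_le_integral => //.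
- exact: emeasurable_funD.
- move=> x _; rewrite -!EFinM -EFinD lee_fin /=.
  by have := sqr_ge0 (f x - g x)%R; nra.
Qed.

Lemma sqmean_comp (U : T -> T) f : measurable_fun [set: T] U ->
  (forall A, measurable A -> P (U @^-1` A) = P A) ->
  measurable_fun [set: T] f -> sqmean (f \o U) = sqmean f.
Proof.
move=> mU PU mf; rewrite /sqmean.
transitivity (\int[pushforward P U]_x esqr f x).
  rewrite ge0_integral_pushforward//; first exact: measurable_sqr.
  by move=> x _; rewrite lee_fin sqr_ge0.
by apply: eq_measure_integral => A mA _; exact: PU.
Qed.

Lemma Lfun2_sqmean f : f \in Lfun P 2%:E ->
  measurable_fun [set: T] f /\ sqmean f < +oo.
Proof.
move=> Lf; have := Lfun2_integrable_sqr Lf => /integrableP[mf2 if2].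
split; first by move: Lf; rewrite inE => /andP[]; rewrite inE.
apply: le_lt_trans if2; rewrite le_eqVlt; apply/orP; left; apply/eqP.
by apply: eq_integral => x _; rewrite /= ger0_norm// sqr_ge0.
Qed.

Import HBSimple.

Lemma sqmean_approx f (e : R) : measurable_fun [set: T] f -> sqmean f < +oo ->
  (0 < e)%R -> exists s : {sfun T >-> R}, sqmean (f \- s)%R < e%:E.
Proof.
move=> mf f2 e0.
have mfE : measurable_fun [set: T] (EFin \o f) by exact/measurable_EFinP.
(* The approximating simple functions are cut off where they exceed [`|f| + 1],
   so that dominated convergence applies. *)
have [g gf] := approximation_sfun measurableT mfE.
pose A n := [set x | (`|g n x| <= `|f x| + 1)%R].
have mg n : measurable_fun [set: T] (g n) by exact: measurable_funPT.
have mA n : measurable (A n).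
  have -> : A n = (fun x => (`|f x| + 1 - `|g n x|)%R) @^-1` `[0%R, +oo[%classic.
    by apply/seteqP; split => x; rewrite /A/= in_itv/= andbT subr_ge0.
  rewrite -[X in measurable X]setTI; apply: measurable_funB => //.
    by apply: measurable_funD => //; exact: measurableT_comp.
  exact: measurableT_comp.
have [s sE] : exists s : {sfun T >-> R}^nat,
    forall n x, s n x = if x \in A n then g n x else 0%R.
  exists (fun n => g n * indic_sfun _ (mA n))%R => n x.
  rewrite -[LHS]/(g n x * \1_(A n) x)%R indicE.
  by case: (x \in A n); rewrite ?mulr1 ?mulr0.
have ms n : measurable_fun [set: T] (s n) by exact: measurable_funPT.
have if2 : P.-integrable [set: T] (esqr f).
  apply/integrableP; split; first exact: measurable_sqr.
  by under eq_integral do rewrite gee0_abs ?lee_fin ?sqr_ge0//.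
(* After the cut-off, |f - s| <= 2 |f| + 1, whose square is at most 8 f^2 + 2. *)
pose h : T -> \bar R := (fun x => 8%:E * esqr f x) \+ cst 2%:E.
have ih : P.-integrable [set: T] h.
  by apply: integrableD => //; [exact: integrableZl|exact: finite_measure_integrable_cst].
have le_h n x : esqr (f \- s n)%R x <= h x.
  rewrite /h /esqr /= -EFinM -EFinD lee_fin sE.
  have [xA|xA] := boolP (x \in A n); last first.
    by rewrite subr0; have := sqr_ge0 (f x); lra.
  move: xA; rewrite inE /A/=; set a := f x; set b := g n x => ab.
  apply: (@le_trans _ _ ((`|a| + `|b|) ^+ 2)%R).
    by rewrite -[leLHS]real_normK ?num_real// ler_pXn2r ?nnegrE ?addr_ge0// ler_normB.
  apply: (@le_trans _ _ ((2 * `|a| + 1) ^+ 2)%R).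
    by rewrite ler_pXn2r ?nnegrE ?addr_ge0 ?mulr_ge0//; lra.
  by have := sqr_ge0 (2 * `|a| - 1)%R; have := real_normK (num_real a); nra.
have msq n : measurable_fun [set: T] (esqr (f \- s n)%R).
  by apply: measurable_sqr; apply: measurable_funB.
have [] := @dominated_convergence _ _ _ P setT measurableT
    (fun n => esqr (f \- s n)%R) (cst 0) h msq.
- exact: measurable_cst.
- apply: aeW => x _; apply: cvg_EFin; first exact: nearW.
  have /fine_cvg gx : EFin \o g ^~ x @ \oo --> (f x)%:E by exact: gf.
  have : ((f x - g n x) ^+ 2)%R @[n --> \oo] --> (0 : R)%R.
    have -> : (0 = (f x - f x) * (f x - f x) :> R)%R by rewrite subrr mul0r.
    by apply: cvgM; apply: cvgB => //; exact: cvg_cst.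
  apply: cvg_trans; apply: near_eq_cvg.
  (* At each point the cut-off is inactive as soon as [g n x] is within 1 of [f x]. *)
  have /cvgrPdist_lt/(_ 1%R ltr01) := gx; apply: filterS => n /= dn.
  rewrite /esqr/= sE mem_set//.
  rewrite /A/= -[X in (`|X| <= _)%R](subrK (f x)) addrC.
  apply: le_trans (ler_normD _ _) _; rewrite lerD2l -normrN opprB; exact: ltW.
- exact: ih.
- apply: aeW => x n _; rewrite gee0_abs ?lee_fin ?sqr_ge0//; exact: le_h.
move=> _ cv _.
have /fine_cvgP[fincv /cvgrPdist_lt/(_ e e0)] := cv.
move=> lt_e; have [n _ /(_ n (leqnn n))[/= fn en]] := filterI fincv lt_e.
exists (s n).
have -> : sqmean (f \- s n)%R = \int[P]_x `|esqr (f \- s n)%R x - cst 0 x|.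
  by apply: eq_integral => x _; rewrite sube0 gee0_abs// lee_fin sqr_ge0.
rewrite -(fineK fn) lte_fin; apply: le_lt_trans en.
by rewrite sub0r normrN ler_norm.
Qed.

Section Rigidity.
Variable U : nat -> T -> T.
Hypothesis mU : forall n, measurable_fun [set: T] (U n).
Hypothesis PU : forall n A, measurable A -> P (U n @^-1` A) = P A.
Hypothesis rigidU : forall A, measurable A ->
  dist P (U n @^-1` A) A @[n --> \oo] --> (0 : R)%R.

Lemma measurable_preU n A : measurable A -> measurable (U n @^-1` A).
Proof. by move=> mA; rewrite -[X in measurable X]setTI; exact: mU. Qed.

Lemma pr_bigsetU (I : Type) (r : seq I) (A : I -> set T) :
  (forall i, measurable (A i)) ->
  (fine (P (\big[setU/set0]_(i <- r) A i)) <= \sum_(i <- r) fine (P (A i)))%R.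
Proof.
move=> mA; elim: r => [|i r IH]; first by rewrite !big_nil measure0.
have mr : measurable (\big[setU/set0]_(j <- r) A j) by exact: bigsetU_measurable.
rewrite !big_cons; apply: (le_trans _ (lerD (lexx _) IH)).
by apply: pr_le_add => //; exact: measurableU.
Qed.

(** A simple function changes along [U n] only on the symmetric differences of its finitely many
    level sets with their preimages. *)
Lemma rigid_sfun (s : {sfun T >-> R}) (e : R) : (0 < e)%R ->
  \forall n \near \oo, sqmean (s \o U n \- s)%R < e%:E.
Proof.
move=> e0; have /finite_seqP[r sr] := fimfunP s.
have mpre y : measurable (s @^-1` [set y]) by exact: measurable_funPTI.
pose D n y := (U n @^-1` (s @^-1` [set y])) `+` (s @^-1` [set y]).
have mD n y : measurable (D n y) by apply: measurableY => //; exact: measurable_preU.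
pose B n := \big[setU/set0]_(y <- r) D n y.
have mB n : measurable (B n) by apply: bigsetU_measurable.
have B0 : fine (P (B n)) @[n --> \oo] --> (0 : R)%R.
  apply: (@squeeze_cvgr _ _ _ _ (cst 0%R) (fun n => \sum_(y <- r) fine (P (D n y)))%R).
  - by apply: nearW => n; rewrite pr_ge0 pr_bigsetU.
  - exact: cvg_cst.
  - rewrite [X in _ --> X](_ : 0 = \sum_(y <- r) (0 : R))%R; last by rewrite big1_eq.
    by apply: cvg_big => [|y _]; [exact: add_continuous|exact: rigidU].
have [C [Creal sC]] := simple_bounded s.
pose K := (`|C| + 1)%R.
have sK x : (`|s x| <= K)%R.
  by apply: (sC K) => //; rewrite /K (le_lt_trans (ler_norm _))// ltrDl.
have K0 : (0 < K)%R by rewrite ltr_wpDl.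
(* Two values bounded by [K] differ by at most [2 * K], whence the constant [4 * K ^+ 2]. *)
have le n : sqmean (s \o U n \- s)%R <= (4 * K ^+ 2)%:E * P (B n).
  have mI : measurable_fun [set: T] (fun x => (\1_(B n) x)%:E : \bar R).
    exact/measurable_EFinP.
  have <- : \int[P]_x ((4 * K ^+ 2)%:E * (\1_(B n) x)%:E) = (4 * K ^+ 2)%:E * P (B n).
    rewrite ge0_integralZl_EFin//.
    - by rewrite integral_indic// setIT.
    - by rewrite mulr_ge0// sqr_ge0.
  apply: ge0_le_integral => //.
  - by move=> x _; rewrite lee_fin sqr_ge0.
  - apply: measurable_sqr; apply: measurable_funB => //.
    by apply: measurableT_comp.
  - exact: measurable_funeM.
  move=> x _; rewrite -EFinM lee_fin /= indicE.
  have [xB|xB] := boolP (x \in B n).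
    rewrite mulr1; have := sK x; have := sK (U n x).
    rewrite !ler_norml => /andP[? ?] /andP[? ?]; nra.
  rewrite mulr0; suff -> : s (U n x) = s x by rewrite subrr expr0n.
  apply: contrapT => sx; case/negP: xB; rewrite inE /B -bigcup_seq.
  exists (s x); first by have := imageT s x; rewrite sr.
  by right; split.
have eK : (0 < e / (4 * K ^+ 2))%R by rewrite divr_gt0// mulr_gt0// exprn_gt0.
have /cvgrPdist_lt/(_ _ eK) := B0; apply: filterS => n.
rewrite sub0r normrN ger0_norm ?pr_ge0// ltr_pdivlMr ?mulr_gt0 ?exprn_gt0// => dn.
apply: le_lt_trans (le n) _.
by rewrite -EFin_pr// -EFinM lte_fin mulrC.
Qed.

Lemma rigid_Lnorm f : f \in Lfun P 2%:E ->
  'N[P]_2[(fun x => (f (U n x) - f x)%:E)] @[n --> \oo] --> 0.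
Proof.
move=> /Lfun2_sqmean[mf f2].
have mfU n : measurable_fun [set: T] (f \o U n) by apply: measurableT_comp.
have small e : (0 < e)%R -> \forall n \near \oo, sqmean (f \o U n \- f)%R < e%:E.
  (* With three terms below a = e / 11, two uses of [sqmeanD_le] give 2a + 2(2a + 2a) = 10a < e. *)
  move=> e0; have e10 : (0 < e / 11)%R by rewrite divr_gt0.
  have [s fs] := sqmean_approx mf f2 e10.
  have := rigid_sfun s e10; apply: filterS => n sn.
  have ms : measurable_fun [set: T] s by exact: measurable_funPT.
  have mfs : measurable_fun [set: T] (f \- s)%R by exact: measurable_funB.
  have msf : measurable_fun [set: T] (s \- f)%R by exact: measurable_funB.
  have msU : measurable_fun [set: T] (s \o U n \- s)%R.
    by apply: measurable_funB => //; exact: measurableT_comp.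
  have -> : (f \o U n \- f)%R =
      (((f \- s) \o U n) \+ ((s \o U n \- s) \+ (s \- f)))%R.
    by apply/funext => x /=; rewrite !addrA !subrK.
  apply: le_lt_trans (sqmeanD_le _ _) _ => //.
  - by apply: measurableT_comp.
  - exact: measurable_funD.
  rewrite sqmean_comp//; last exact: PU.
  have sfE : sqmean (s \- f)%R = sqmean (f \- s)%R.
    by apply: eq_integral => x _; rewrite /esqr /= -sqrrN opprB.
  have := sqmeanD_le msU msf; rewrite sfE => h.
  apply: (@le_lt_trans _ _ (2%:E * (e / 11)%:E +
     2%:E * (2%:E * (e / 11)%:E + 2%:E * (e / 11)%:E))).
    apply: leeD; first by rewrite lee_pmul2l// ltW.
    rewrite lee_pmul2l//; apply: (le_trans h).
    by apply: leeD; rewrite lee_pmul2l// ltW.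
  by rewrite -!(EFinM, EFinD) lte_fin; lra.
have N2 n : 'N[P]_2[(fun x => (f (U n x) - f x)%:E)] =
    sqmean (f \o U n \- f)%R `^ 2^-1.
  rewrite unlock; congr (_ `^ _); apply: eq_integral => x _.
  by rewrite /esqr /= powR_mulrn ?normr_ge0// real_normK ?num_real.
apply/fine_cvgP; split.
  have := small 1%R ltr01; apply: filterS => n sn; rewrite N2.
  have : sqmean (f \o U n \- f)%R \is a fin_num.
    by rewrite ge0_fin_numE ?sqmean_ge0// (lt_trans sn)// ltry.
  by move=> /fineK <-; rewrite poweR_EFin.
apply/cvgrPdist_lt => e e0.
have := small (e ^+ 2)%R (exprn_gt0 2 e0); apply: filterS => n sn.
rewrite sub0r normrN /= N2.
have fn : sqmean (f \o U n \- f)%R \is a fin_num.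
  by rewrite ge0_fin_numE ?sqmean_ge0// (lt_trans sn)// ltry.
move: sn; rewrite -(fineK fn) poweR_EFin lte_fin /=.
have := fine_ge0 (sqmean_ge0 (f \o U n \- f)%R); set r := fine _ => r0 re.
rewrite ger0_norm ?powR_ge0// powR12_sqrt//.
by rewrite -(ger0_norm (ltW e0)) -sqrtr_sqr ltr_sqrt// exprn_gt0.
Qed.

End Rigidity.


End SquareMean.

(** The last blocks of [y] and [y + z] are both nonzero, so the twist vanishes at both, and the
    first blocks agree. *)
Lemma bond_invariant (F : finFieldType) n r (y z : 'rV[F]_(n + (n + r))) :
  lsubmx z = 0 -> rsubmx (rsubmx y) != 0 ->
  rsubmx (rsubmx y) != - rsubmx (rsubmx z) -> bond (y + z) = bond y.
Proof.
move=> z0 y0 yz; rewrite /bond /twist !linearD/= z0 addr0 (negPf y0).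
by rewrite addr_eq0 (negPf yz).
Qed.

(** * Rigidity on measurable sets *)

Section SetRigidity.
Variables (F : finFieldType) (R : realType).
Local Notation q := #|F|.
Local Notation Gam k := 'rV[F]_(ldim F k).
Local Notation M k := (#|{: Gam k}|%:R : R).
Local Notation X := (unit_space R).
Local Notation mu := (unit_prob R).
Variable L : {poly F} -> {poly F}.
Hypothesis LD : {morph L : p r / p + r}.
Hypothesis size_L : forall p, size (L p) = size p.
Local Notation T := (@exch F R L : {poly F} -> X -> X).
Implicit Types g h : {poly F}.

Definition last_block k (y : Gam k.+1) : 'rV[F]_(rdim F k) :=
  rsubmx (rsubmx y : 'rV[F]_(ldim F k + rdim F k)).

Lemma pr_last_block k (c : 'rV[F]_(rdim F k)) :
  fine (mu (cylinder [pred y : Gam k.+1 | last_block y == c])) =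
  (#|{: 'rV[F]_(rdim F k)}|%:R)^-1.
Proof.
have sum1 : \sum_e (e == c)%:R = 1 :> R.
  by rewrite (bigD1 c)//= eqxx big1 ?addr0// => e /negPf ->.
rewrite pr_cylinder (sum_row_mx (fun y => _)).
under eq_bigr => x _ do rewrite sum_row_mx.
under eq_bigr => x _ do under eq_bigr => w _ do under eq_bigr => e _ do
  rewrite /= /last_block !row_mxKr.
under eq_bigr => x _ do under eq_bigr => w _ do rewrite sum1.
have DE : #|{: 'rV[F]_(ldim F k + rdim F k)}| =
  (#|{: Gam k}| * #|{: 'rV[F]_(rdim F k)}|)%N by rewrite !card_mx !mul1n expnD.
rewrite !sumr_const -mulrnA card_GamS DE mulnA [in X in _ / X]natrM invfM mulrA.
rewrite divff ?mul1r// pnatr_eq0 muln_eq0 negb_or -lt0n.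
by rewrite card_Gam_gt0.
Qed.

(** By [bond_invariant] the level k index can change only where the last block is 0 or [- e], two
    events of probability 1 / |E_k| each. *)
Lemma dist_exch_cylinder k (A : set X) g : is_cylinder F k A ->
  (size g <= ldim F k.+1)%N -> gcoord L k g = 0 ->
  dist mu (T g @^-1` A) A <= 2 / #|{: 'rV[F]_(rdim F k)}|%:R.
Proof.
move=> [S ->] gk g0.
pose e := last_block (gcoord L k.+1 g).
pose W c : set X := cylinder [pred y : Gam k.+1 | last_block y == c].
have mW c : measurable (W c) by exact: measurable_cylinder.
have mA : measurable (cylinder S : set X) by exact: measurable_cylinder.
have mTA := measurable_preimage_exch size_L g mA.
have -> : 2 / #|{: 'rV[F]_(rdim F k)}|%:R = fine (mu (W 0)) + fine (mu (W (- e))).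
  by rewrite !pr_last_block; lra.
rewrite /dist -muI01; apply: pr_le_add => //.
  by apply/measurableI01; exact: measurableY.
move=> x [+ /=]; rewrite in_itv/= => + x01.
have [|W0] := eqVneq (last_block (cell F k.+1 x)) 0.
  by move=> xW _; left; split => //=; rewrite xW.
have [|We] := eqVneq (last_block (cell F k.+1 x)) (- e).
  by move=> xW _; right; split => //=; rewrite xW.
have cE : cell F k (T g x) = cell F k x.
  have x01' : 0 <= T g x < 1 by rewrite exch01.
  rewrite -(cell_bond F k x01') -(cell_bond F k x01) (cell_exch size_L x01 gk).
  by apply: bond_invariant => //; rewrite lsubmx_gcoord.
have x01' : 0 <= T g x < 1 by rewrite exch01.
have SE : cylinder S (T g x) <-> cylinder S x.
  by rewrite /cylinder/= cE; split => -[].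
by rewrite /setY/= => -[] [] /SE.
Qed.

Lemma level_exists K n : (ldim F K <= n)%N ->
  exists k, [/\ (K <= k)%N, (ldim F k <= n)%N & (n < ldim F k.+1)%N].
Proof.
move=> Kn; have ex : exists k, (ldim F k <= n)%N by exists K.
have ub k : (ldim F k <= n)%N -> (k <= n)%N by apply: leq_trans (leq_ldim F k).
case: (ex_maxnP ex ub) => k kn kmax; exists k; split => //; first exact: kmax.
by rewrite ltnNge; apply/negP => /kmax; rewrite ltnn.
Qed.

(** The lower estimate [rdim_gt] yields |E_k| > k / q. *)
Lemma card_block_gt (e : R) : 0 < e -> exists K, forall k, (K <= k)%N ->
  2 / #|{: 'rV[F]_(rdim F k)}|%:R < e.
Proof.
move=> e0; have q0 : 0 < q%:R :> R.
  by rewrite ltr0n ltnW// card_finNzRing_gt1.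
have E0 k : 0 < #|{: 'rV[F]_(rdim F k)}|%:R :> R.
  by rewrite ltr0n; apply/card_gt0P; exists 0.
exists (Num.bound (2 * q%:R / e)) => k Kk.
have qk : 2 * q%:R / e < k%:R.
  apply: lt_le_trans (archi_boundP _) _; first by rewrite divr_ge0 ?mulr_ge0// ltW.
  by rewrite ler_nat.
have kE : k%:R < q%:R * #|{: 'rV[F]_(rdim F k)}|%:R :> R.
  rewrite -natrM ltr_nat card_mx mul1n -expnS.
  by apply: leq_ltn_trans (rdim_gt F k); rewrite leq_addr.
have := lt_trans qk kE; rewrite !ltr_pdivrMr// => h.
by rewrite -(ltr_pM2l q0) mulrC mulrCA [e * _]mulrC.
Qed.

Lemma exch_rigid_sets (a : nat -> {poly F}) (n_ : nat -> nat) (A : set X) :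
  (forall n, L (a n) = 'X^(n_ n)) -> (forall n, (n <= n_ n)%N) ->
  measurable A -> dist mu (T (a n) @^-1` A) A @[n --> \oo] --> (0 : R).
Proof.
move=> La n_ge mA; apply/cvgrPdist_lt => e e0.
(* The distance to the approximating cylinder enters twice, and the motion of that cylinder takes
   the remaining half of [e]. *)
have e40 : 0 < e / 4 by rewrite divr_gt0.
have [m [C [cC dC]]] := measurable_approximable F mA e40.
have mC := measurable_is_cylinder cC.
have e20 : 0 < e / 2 by rewrite divr_gt0.
have [K KE] := card_block_gt e20.
exists (ldim F (maxn K m)) => // n /= Kn.
(* At this level the monomial [L (a n)] is a basis vector of the new part of G_(k+1), and its
   coordinates in G_k vanish. Since [n <= n_ n], the level is at least [K] and [m] for large [n]. *)
have [k [Kk kn nk]] := level_exists (leq_trans Kn (n_ge n)).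
rewrite sub0r normrN ger0_norm ?dist_ge0//.
have ank : (size (a n) <= ldim F k.+1)%N by rewrite -size_L La size_polyXn.
have an0 : gcoord L k (a n) = 0.
  rewrite /gcoord La; apply/rowP => i; rewrite !mxE coefXn.
  by case: eqP => // ik; have := ltn_ord i; rewrite ik ltnNge kn.
have cCk : is_cylinder F k C.
  by apply: is_cylinder_le cC; apply: leq_trans (leq_maxr K m) Kk.
have d1 := dist_exch_cylinder cCk ank an0.
have d2 := KE _ (leq_trans (leq_maxl K m) Kk).
have mTA := measurable_preimage_exch size_L (a n) mA.
have mTC := measurable_preimage_exch size_L (a n) mC.
have d3 : dist mu (T (a n) @^-1` A) (T (a n) @^-1` C) = dist mu A C.
  by rewrite /dist -(mu_preimage_exch size_L (a n) (measurableY mA mC)).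
apply: le_lt_trans (dist_triangle _ mTA mTC mA) _; rewrite d3.
apply: le_lt_trans (lerD (lexx _) (dist_triangle _ mTC mC mA)) _.
by rewrite (distC _ C A); lra.
Qed.

End SetRigidity.

(** * Continued fractions *)

Section DegreeBasis.
Variables (F : fieldType) (b : nat -> {poly F}).
Hypothesis size_b : forall i, size (b i) = i.+1.
Implicit Types p r : {poly F}.

Definition bcomb p := \sum_(i < size p) p`_i *: b i.

Lemma bcombE n p : (size p <= n)%N -> bcomb p = \sum_(i < n) p`_i *: b i.
Proof.
move=> pn; rewrite /bcomb -!(big_mkord xpredT (fun i => p`_i *: b i)).
rewrite [RHS](@big_cat_nat _ _ _ (size p))//= [X in _ = _ + X]big_nat_cond [X in _ = _ + X]big1 ?addr0//.
by move=> i /andP[/andP[pi _] _]; rewrite nth_default ?scale0r.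
Qed.

Lemma bcombD : {morph bcomb : p r / p + r}.
Proof.
move=> p r; pose n := maxn (size p) (size r).
rewrite (@bcombE n) ?size_polyD// (@bcombE n p) ?leq_maxl// (@bcombE n r) ?leq_maxr//.
by rewrite -big_split; apply: eq_bigr => i _; rewrite coefD scalerDl.
Qed.

Lemma size_bcomb p : size (bcomb p) = size p.
Proof.
rewrite /bcomb; case pn : (size p) => [|n]; first by rewrite big_ord0 size_poly0.
have pn0 : p`_n != 0.
  by rewrite -[n]/(n.+1.-1) -pn -/(lead_coef p) lead_coef_eq0 -size_poly_eq0 pn.
rewrite big_ord_recr/= addrC size_polyDl size_scale// size_b//.
rewrite ltnS; apply: leq_trans (size_sum _ _ _) _; apply/bigmax_leqP => i _.
by apply: leq_trans (size_scale_leq _ _) _; rewrite size_b.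
Qed.

Lemma bcombXn n : bcomb 'X^n = b n.
Proof.
rewrite /bcomb size_polyXn big_ord_recr/= coefXn eqxx scale1r big1 ?add0r// => i _.
by rewrite coefXn ltn_eqF// scale0r.
Qed.

Lemma bcombZ c p : bcomb (c *: p) = c *: bcomb p.
Proof.
rewrite (@bcombE (size p)) ?size_scale_leq// /bcomb scaler_sumr.
by apply: eq_bigr => i _; rewrite coefZ scalerA.
Qed.

Lemma bcomb_inj : injective bcomb.
Proof.
move=> p r pr; apply/eqP; rewrite -subr_eq0 -size_poly_eq0 -size_bcomb bcombD.
by rewrite -scaleN1r bcombZ scaleN1r pr subrr size_poly0.
Qed.

(** Induction on the size: a multiple of the basis element of the same degree cancels the leading
    term. *)
Lemma bcomb_surj p : exists r, bcomb r = p.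
Proof.
have [n] := ubnP (size p); elim: n p => // n IH p pn.
have [p0|p0] := eqVneq p 0.
  by exists 0; apply/eqP; rewrite p0 -size_poly_eq0 size_bcomb size_poly0.
pose m := (size p).-1; pose c := lead_coef p / lead_coef (b m).
have pm : size p = m.+1 by rewrite prednK// lt0n size_poly_eq0.
have bm0 : lead_coef (b m) != 0 by rewrite lead_coef_eq0 -size_poly_eq0 size_b.
have [|r rE] := IH (p - c *: b m).
  rewrite pm ltnS in pn; apply: leq_trans pn; rewrite ltnS; apply/leq_sizeP => i mi.
  rewrite coefB coefZ; move: mi; rewrite leq_eqVlt => /orP[/eqP <-|mi].
    have -> : p`_m = lead_coef p by [].
    have -> : (b m)`_m = lead_coef (b m) by rewrite lead_coefE size_b.
    by rewrite divfK// subrr.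
  by rewrite !nth_default ?mulr0 ?subr0 ?size_b ?pm.
by exists (r + c *: 'X^m); rewrite bcombD rE bcombZ bcombXn subrK.
Qed.

End DegreeBasis.

(** Monomials in the missing degrees complete the [a n] to a family with one element of each degree;
    [L] is the inverse of the linear map sending ['X^i] to the element of degree i. *)
Lemma degree_basis_change (F : fieldType) (a : nat -> {poly F}) :
  (forall n, (size (a n) < size (a n.+1))%N) -> (0 < size (a 0%N))%N ->
  exists L : {poly F} -> {poly F},
    [/\ {morph L : p r / p + r}, forall p, size (L p) = size p,
        forall p, exists r, L r = p & forall n, L (a n) = 'X^((size (a n)).-1)].
Proof.
move=> a_incr a0.
have a_lt : {homo (fun n => size (a n)) : m n / (m < n)%N} by apply: homo_ltn => //; exact: ltn_trans.
have a_pos n : (0 < size (a n))%N.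
  by case: n => // n; apply: leq_trans (a_incr n).
(* The sizes increase strictly, so at most one [a n] has degree i and the choice is consistent. *)
have bP i : exists p : {poly F}, size p = i.+1 /\ forall n, size (a n) = i.+1 -> p = a n.
  have [[n an]|nan] := pselect (exists n, size (a n) = i.+1).
    exists (a n); split=> // m am; case: (ltngtP m n) => [/a_lt|/a_lt|->//];
      by rewrite am an ltnn.
  exists 'X^i; rewrite size_polyXn; split=> // n an.
  by case: nan; exists n.
pose b i := projT1 (cid (bP i)).
have size_b i : size (b i) = i.+1 by rewrite /b; case: cid => p [].
have ba n : b (size (a n)).-1 = a n.
  by rewrite /b; case: cid => p [_ /=]; apply; rewrite prednK.
pose L p := projT1 (cid (bcomb_surj size_b p)).
have LK p : bcomb b (L p) = p by rewrite /L; case: cid.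
have inj := bcomb_inj size_b.
have KL p : L (bcomb b p) = p by apply: inj; rewrite LK.
exists L; split.
- by move=> p r; apply: inj; rewrite bcombD !LK.
- by move=> p; rewrite -[in RHS](LK p) size_bcomb.
- by move=> p; exists (bcomb b p).
- by move=> n; rewrite -[X in L X]ba -[X in L X]bcombXn KL.
Qed.

(** * Degrees of the denominators of the convergents *)

Section LaurentPolynomials.
Variable F : fieldType.
Implicit Types (p r : {poly F}) (x y : laurent F) (N M : int).

Lemma lpolyD : {morph @lpoly F : p r / p + r}.
Proof.
move=> p r; apply: laurentP; apply/funext => -[k|k] /=; first by rewrite coefD.
by rewrite addr0.
Qed.

Lemma lpolyM : {morph @lpoly F : p r / p * r}.
Proof.
move=> p r; apply: laurentP; apply/funext => -[k|k] /=; last first.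
  rewrite /lmul_coef fsbig1// => -[i|i] _; last by rewrite mul0r.
  rewrite [X in _ * X](_ : _ = 0) ?mulr0//.
  by rewrite (_ : Negz k - i%:Z = Negz (k + i)%N)//; lia.
rewrite /lmul_coef (fsbigE (map Posz (iota 0 k.+1)))//.
- rewrite big_map -[iota 0 k.+1]/(index_iota 0 k.+1).
  rewrite (eq_bigl xpredT); last by move=> j; rewrite mem_set.
  rewrite big_mkord coefM; apply: eq_bigr => j _ /=.
  by rewrite subzn// -ltnS.
- by rewrite map_inj_uniq ?iota_uniq// => i j [].
- move=> [i|i] _; last by rewrite [lpoly_coef _ _]/= mul0r.
  move=> ik; rewrite [X in _ * X](_ : _ = 0) ?mulr0//.
  have ki : (k < i)%N.
    rewrite ltnNge; apply: contra ik => ik; apply/mapP; exists i => //.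
    by rewrite mem_iota.
  by rewrite (_ : k%:Z - i%:Z = Negz (i - k.+1)%N)//; lia.
Qed.

Lemma lpoly_eq0 p : (lpoly p == 0) = (p == 0).
Proof.
apply/eqP/eqP => [p0|->].
  by apply/polyP => k; have := congr1 (fun x : laurent F => x k%:Z) p0; rewrite coef0.
by apply: laurentP; apply/funext => -[k|k] /=; rewrite ?coef0.
Qed.

Lemma rational_addl p x : rational_laurent x -> rational_laurent (lpoly p + x).
Proof.
move=> [u [v [v0 ->]]]; exists (p * v + u), v; split=> //.
by rewrite lpolyD lpolyM mulrDl mulfK// lpoly_eq0.
Qed.

Lemma rational_inv x : rational_laurent x -> rational_laurent (1 / x).
Proof.
move=> [u [v [v0 ->]]]; have [u0|u0] := eqVneq u 0.
  exists 0, 1; rewrite oner_eq0; split => //; rewrite u0.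
  by rewrite (_ : lpoly 0 = 0) ?mul0r ?invr0 ?mulr0//; apply/eqP; rewrite lpoly_eq0.
by exists v, u; split=> //; rewrite div1r invf_div.
Qed.

Lemma lmul_top x y N M : bounded_above x N -> bounded_above y M ->
  (x * y) (N + M) = x N * y M.
Proof.
move=> xN yM; rewrite -[LHS]/(lmul_coef x y (N + M)).
by have := lmul_coefE 0 xN yM; rewrite big_ord1 !subr0.
Qed.

Definition in_fractional x := forall n : nat, x n%:Z = 0.

Lemma frac_part_in x : in_fractional (frac_part x).
Proof. by move=> n; rewrite /frac_part /= int_partE subrr. Qed.

Lemma gauss_map_in x : in_fractional (gauss_map x).
Proof. by rewrite /gauss_map; case: ifP => _ //; exact: frac_part_in. Qed.

(** The top exponents of [x] and [1 / x] add up to 0, and that of [x] is negative, so [1 / x] has a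
    nonzero coefficient at a positive power of t. *)
Lemma size_int_part_inv x : x != 0 -> in_fractional x ->
  (1 < size (int_part (1 / x)))%N.
Proof.
move=> x0 xI; have y0 : 1 / x != 0 by rewrite div1r invr_eq0.
have [N xN xNb] := laurent_top x0; have [M yM yMb] := laurent_top y0.
have NM : N + M = 0.
  have := lmul_top xNb yMb; rewrite div1r divff//.
  rewrite -[LHS]/((N + M == 0)%:R); case: eqP => // _ /esym/eqP.
  by rewrite mulf_eq0 (negPf xN) -div1r (negPf yM).
have N0 : N < 0.
  by rewrite ltNge; apply/negP; case: N xN {xNb NM} => // n; rewrite xI eqxx.
have M0 : M = `|M|%N%:Z by lia.
apply: (@leq_trans `|M|.+1); first by lia.
rewrite ltnNge; apply: contra yM => sM.
by rewrite M0 -int_partE nth_default.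
Qed.

(** If an iterate vanished, running the algorithm backwards through y = 1 / (a + y') would show
    every earlier iterate, and finally [x], to be rational. *)
Lemma gauss_iter_neq0 x m : ~ rational_laurent x ->
  iter m (@gauss_map F) (frac_part x) != 0.
Proof.
move=> xr; apply: contra_not_neq xr => m0.
have /(_ m) : forall i, (i <= m)%N ->
    rational_laurent (iter (m - i) (@gauss_map F) (frac_part x)).
  elim=> [_|i IH im].
    rewrite subn0 m0; exists 0, 1; rewrite oner_eq0; split => //.
    by rewrite (_ : lpoly 0 = 0) ?mul0r//; apply/eqP; rewrite lpoly_eq0.
  have := IH (ltnW im); rewrite -[(m - i)%N](@prednK) ?subn_gt0// -subnS iterS.
  set y := iter _ _ _; rewrite /gauss_map; case: eqP => [->|_] //.
  move=> /(rational_addl (int_part (1 / y))); rewrite /frac_part addrC subrK.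
  by move=> /rational_inv; rewrite !div1r invrK.
rewrite subnn leqnn => /(_ isT)/= /(rational_addl (int_part x)).
by rewrite /frac_part addrC subrK.
Qed.

(** All quotients after the initial one have positive degree, so in the recurrence the product
    strictly dominates both the previous denominators. *)
Lemma size_cf_denom x n : ~ rational_laurent x ->
  (size (cf_denom x n) < size (cf_denom x n.+1))%N.
Proof.
move=> xr.
have sq m : (1 < size (cf_quotient x m.+1))%N.
  apply: size_int_part_inv; first exact: gauss_iter_neq0.
  by case: m => [|m]; [exact: frac_part_in|exact: gauss_map_in].
suff : forall m, (0 < size (cf_denom x m))%N /\
    (size (cf_denom x m) < size (cf_denom x m.+1))%N by case/(_ n).
elim=> [|m [m0 IH]]; first by rewrite size_poly1; split=> //; exact: sq.
have m1 : (0 < size (cf_denom x m.+1))%N by exact: leq_trans IH.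
split=> //; rewrite -[cf_denom x m.+2]/(cf_quotient x m.+2 * cf_denom x m.+1 + cf_denom x m).
have lt : (size (cf_denom x m.+1) < size (cf_quotient x m.+2 * cf_denom x m.+1)%R)%N.
  rewrite size_mul -?size_poly_gt0//; last exact: ltnW (sq _).
  move: (sq m.+1); case: (size (cf_quotient x m.+2)) => [|[|k]] // _.
  by rewrite !addSn /= ltnS leq_addl.
by rewrite size_polyDl// (ltn_trans IH).
Qed.

End LaurentPolynomials.

Theorem theorem4p8 (R : realType) (F : finFieldType) (alpha : laurent F)
    (halpha : ~ rational_laurent alpha) :
  exists (d : measure_display) (X : measurableType d) (mu : probability X R)
         (T : {poly F} -> X -> X),
    [/\ measure_preserving_system mu T,
        free_action mu T,
        weakly_mixing mu T &
        rigidity_sequence mu T (cf_denom alpha)].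
Proof.
have incr n := size_cf_denom n halpha.
have [|L [LD size_L L_surj La]] := degree_basis_change incr.
  by rewrite size_poly1.
(* Strictly increasing degrees give the lower bound on the exponents of the monomials that rigidity
   uses. *)
have nle n : (n <= (size (cf_denom alpha n)).-1)%N.
  suff : (n < size (cf_denom alpha n))%N by case: (size _).
  elim: n => [|n IH]; first by rewrite size_poly1.
  exact: leq_ltn_trans IH (incr n).
exists default_measure_display, (unit_space R), (unit_prob R), (@exch F R L).
split.
- split; [exact: unit_space_lebesgue|exact: exch_preserving].
- exact: exch_free_action.
- exact: exch_weakly_mixing.
- pose U n : unit_space R -> unit_space R := exch L (cf_denom alpha n).
  have mU n : measurable_fun [set: unit_space R] (U n) by exact: measurable_exch.
  have PU n A : measurable A -> unit_prob R (U n @^-1` A) = unit_prob R A.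
    exact: mu_preimage_exch.
  have rigidU A : measurable A ->
      dist (unit_prob R) (U n @^-1` A) A @[n --> \oo] --> (0 : R).
    by move=> mA; apply: (exch_rigid_sets size_L La nle mA).
  move=> f Lf; exact: (rigid_Lnorm mU PU rigidU Lf).
Qed.
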